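(* Let $K$ be a field of characteristic zero, $S=K[x,y]$, and let $I=QS$ be the defining ideal of a central arrangement in $K^2$. Then the ring $\mathcal{D}(S/I)\simeq\mathcal{D}(I)/I\mathcal{D}(S)$ is Noetherian, i.e., it is both right Noetherian and left Noetherian.
   Context: For a commutative $K$-algebra $R$, $\mathcal{D}^0(R)=\{\theta\in\mathrm{End}_K(R)\mid \theta a-a\theta=0 \text{ for all } a\in R\}$, $\mathcal{D}^m(R)=\{\theta\in\mathrm{End}_K(R)\mid\theta a-a\theta\in\mathcal{D}^{m-1}(R)\text{ for all }a\in R\}$ for $m\ge1$, and $\mathcal{D}(R)=\bigcup_{m\ge0}\mathcal{D}^m(R)$ is the ring of differential operators of $R$. For $S=K[x,y]$, $\mathcal{D}(S)=K[x,y]\langle\partial_x,\partial_y\rangle$ is the Weyl algebra. A central arrangement in $K^2$ is a finite set $\{H_1,\dots,H_r\}$ ($r\ge1$) of distinct lines through the origin; $p_i$ is a homogeneous polynomial of degree $1$ defining $H_i$, $Q=p_1\cdots p_r$, $I=QS$. $\mathcal{D}(I)=\{\theta\in\mathcal{D}(S)\mid\theta(I)\subseteq I\}$, a subring of $\mathcal{D}(S)$ in which $I\mathcal{D}(S)$ is a two-sided ideal; the isomorphism $\mathcal{D}(S/I)\simeq\mathcal{D}(I)/I\mathcal{D}(S)$ is a known fact. *)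

(* Defs.v *)
From HB Require Import structures.
From mathcomp Require Import all_boot all_algebra.
From mathcomp Require Import boolp classical_sets.
From mathcomp Require Import mpoly.

Set Implicit Arguments.
Unset Strict Implicit.
Unset Printing Implicit Defensive.

Import GRing.Theory.
Local Open Scope ring_scope.
Local Open Scope quotient_scope.

Record left_ideal (A : pzRingType) (J : set A) : Prop := LeftIdeal {
  left_ideal0 : J 0;
  left_idealD : forall x y, J x -> J y -> J (x + y);
  left_idealM : forall a x, J x -> J (a * x)
}.

Record right_ideal (A : pzRingType) (J : set A) : Prop := RightIdeal {
  right_ideal0 : J 0;
  right_idealD : forall x y, J x -> J y -> J (x + y);
  right_idealM : forall a x, J x -> J (x * a)
}.

Definition stationary (T : Type) (J : nat -> set T) : Prop :=
  exists n, forall m, (n <= m)%N -> J m = J n.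

Definition left_noetherian (A : pzRingType) : Prop :=
  forall J : nat -> set A, (forall n, left_ideal (J n)) ->
    (forall n, (J n `<=` J n.+1)%classic) -> stationary J.

Definition right_noetherian (A : pzRingType) : Prop :=
  forall J : nat -> set A, (forall n, right_ideal (J n)) ->
    (forall n, (J n `<=` J n.+1)%classic) -> stationary J.

Definition noetherian (A : pzRingType) : Prop :=
  right_noetherian A /\ left_noetherian A.

(* A copy of [{linear V -> V}] carrying the ring structure whose product is
   composition. *)
Definition kEnd (K : comPzRingType) (V : lmodType K) : Type := {linear V -> V}.

Section EndRing.
Variables (K : comPzRingType) (V : lmodType K).
Implicit Types f g h : kEnd V.

Definition kEnd_fun f : V -> V := (f : {linear V -> V}).
Coercion kEnd_fun : kEnd >-> Funclass.

HB.instance Definition _ := gen_eqMixin (kEnd V).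
HB.instance Definition _ := gen_choiceMixin (kEnd V).

Lemma kEnd_eq f g : f =1 g -> f = g.
Proof.
rewrite /kEnd_fun; case: f => f cf; case: g => g cg /= /funext e.
rewrite -{g}e in cg *; congr GRing.Linear.Pack.
case: cf => -[f1] [f2]; case: cg => -[g1] [g2].
by rewrite (Prop_irrelevance f1 g1) (Prop_irrelevance f2 g2).
Qed.

Definition kEnd_zero : kEnd V := (\0 : {linear V -> V}).
Definition kEnd_opp f : kEnd V := (\- (f : {linear V -> V}) : {linear V -> V}).
Definition kEnd_add f g : kEnd V :=
  ((f : {linear V -> V}) \+ (g : {linear V -> V}) : {linear V -> V}).
Definition kEnd_one : kEnd V := (idfun : {linear V -> V}).
Definition kEnd_mul f g : kEnd V :=
  ((f : {linear V -> V}) \o (g : {linear V -> V}) : {linear V -> V}).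

Fact kEnd_addA : associative kEnd_add.
Proof. by move=> f g h; apply: kEnd_eq => v; apply: addrA. Qed.
Fact kEnd_addC : commutative kEnd_add.
Proof. by move=> f g; apply: kEnd_eq => v; apply: addrC. Qed.
Fact kEnd_add0 : left_id kEnd_zero kEnd_add.
Proof. by move=> f; apply: kEnd_eq => v; apply: add0r. Qed.
Fact kEnd_addN : left_inverse kEnd_zero kEnd_opp kEnd_add.
Proof. by move=> f; apply: kEnd_eq => v; apply: addNr. Qed.

HB.instance Definition _ :=
  GRing.isZmodule.Build (kEnd V) kEnd_addA kEnd_addC kEnd_add0 kEnd_addN.

Fact kEnd_mulA : associative kEnd_mul.
Proof. by move=> f g h; apply: kEnd_eq. Qed.
Fact kEnd_mul1 : left_id kEnd_one kEnd_mul.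
Proof. by move=> f; apply: kEnd_eq. Qed.
Fact kEnd_mulr1 : right_id kEnd_one kEnd_mul.
Proof. by move=> f; apply: kEnd_eq. Qed.
Fact kEnd_mulDl : left_distributive kEnd_mul +%R.
Proof. by move=> f g h; apply: kEnd_eq. Qed.
Fact kEnd_mulDr : right_distributive kEnd_mul +%R.
Proof.
move=> f g h; apply: kEnd_eq => v.
exact: (linearD (f : {linear V -> V})).
Qed.

HB.instance Definition _ := GRing.Zmodule_isPzRing.Build (kEnd V)
  kEnd_mulA kEnd_mul1 kEnd_mulr1 kEnd_mulDl kEnd_mulDr.

Lemma kEndE0 v : (0 : kEnd V) v = 0. Proof. by []. Qed.
Lemma kEndE1 v : (1 : kEnd V) v = v. Proof. by []. Qed.
Lemma kEndED f g v : (f + g) v = f v + g v. Proof. by []. Qed.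
Lemma kEndEN f v : (- f) v = - f v. Proof. by []. Qed.
Lemma kEndEM f g v : (f * g) v = f (g v). Proof. by []. Qed.

End EndRing.

Section DiffOp.
Variables (K : comPzRingType) (R : comAlgType K).
Implicit Types (f g : kEnd R) (a b : R).

Definition mulop a : kEnd R := (a \*o idfun : {linear R -> R}).

Definition bracket f a : kEnd R := f * mulop a - mulop a * f.

Fixpoint diffop_le (m : nat) f : Prop :=
  if m is m'.+1 then forall a, diffop_le m' (bracket f a)
  else forall a, bracket f a = 0.

Definition is_diffop : {pred kEnd R} := fun f => `[< exists m, diffop_le m f >].

Lemma bracketE f a b : bracket f a b = f (a * b) - a * f b.
Proof. by []. Qed.

Fact bracketB f g a : bracket (f - g) a = bracket f a - bracket g a.
Proof. by rewrite /bracket mulrBl mulrBr !opprD !opprK addrACA. Qed.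

Fact bracketM f g a : bracket (f * g) a = f * bracket g a + bracket f a * g.
Proof. by rewrite /bracket mulrBr mulrBl !mulrA addrA subrK. Qed.

Fact bracket0 a : bracket 0 a = 0.
Proof. by rewrite /bracket mul0r mulr0 subr0. Qed.

Fact diffop_le0 m : diffop_le m 0.
Proof. by elim: m => [|m IH] a /=; rewrite bracket0. Qed.

Fact diffop_leS m f : diffop_le m f -> diffop_le m.+1 f.
Proof.
elim: m f => [|m IH] f /= Df a; last exact/IH/Df.
by rewrite Df => b; rewrite bracket0.
Qed.

Fact diffop_le_leq m n f : (m <= n)%N -> diffop_le m f -> diffop_le n f.
Proof.
move=> /subnK <- Df; elim: (n - m)%N => [//|k IH]; exact: diffop_leS.
Qed.

Fact diffop_leB m f g : diffop_le m f -> diffop_le m g -> diffop_le m (f - g).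
Proof.
elim: m f g => [|m IH] f g /= Df Dg a; rewrite bracketB; last exact: IH.
by rewrite Df Dg subr0.
Qed.

Fact diffop_leD m f g : diffop_le m f -> diffop_le m g -> diffop_le m (f + g).
Proof.
move=> Df Dg; rewrite -[g]opprK -[- g]sub0r.
by do 2?apply: diffop_leB => //; apply: diffop_le0.
Qed.

Fact diffop_leM m n f g :
  diffop_le m f -> diffop_le n g -> diffop_le (m + n) (f * g).
Proof.
move: {2}(m + n)%N (leqnn (m + n)) => N; elim: N m n f g => [|N IH] m n f g.
  rewrite leqn0 addn_eq0 => /andP[/eqP-> /eqP->] /= Df Dg a.
  by rewrite bracketM Df Dg mulr0 mul0r addr0.
case: m n => [|m] [|n] leN Df Dg.
- by move=> a; rewrite bracketM Df Dg mulr0 mul0r addr0.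
- by move=> a; rewrite bracketM Df mul0r addr0; apply: (IH 0%N n).
- by move=> a; rewrite bracketM Dg mulr0 add0r addn0 -[m]addn0;
    apply: (IH m 0%N) => //; rewrite addn0 in leN *.
- move=> a; rewrite bracketM -/diffop_le; apply: diffop_leD.
    by rewrite -addSnnS; apply: (IH m.+1 n) => //; rewrite addnS in leN.
  by apply: (IH m n.+1) => //; rewrite addSn in leN.
Qed.

Fact is_diffop_subring : subring_closed is_diffop.
Proof.
split.
- apply/asboolP; exists 0%N => a.
  by rewrite /bracket mul1r mulr1 subrr.
- move=> f g /asboolP[m Df] /asboolP[n Dg]; apply/asboolP; exists (maxn m n).
  by apply: diffop_leB; [apply: diffop_le_leq Df; rewrite leq_maxl
                        |apply: diffop_le_leq Dg; rewrite leq_maxr].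
- move=> f g /asboolP[m Df] /asboolP[n Dg]; apply/asboolP; exists (m + n)%N.
  exact: diffop_leM.
Qed.

Record diffop : Type :=
  DiffOp { diffop_end :> kEnd R; _ : diffop_end \in is_diffop }.

HB.instance Definition _ := [isSub for diffop_end].
HB.instance Definition _ := [Choice of diffop by <:].
HB.instance Definition _ :=
  GRing.SubChoice_isSubPzRing.Build (kEnd R) is_diffop diffop is_diffop_subring.

End DiffOp.

Arguments diffop K R : clear implicits.

Section QuotientAlgebra.
Variables (K : comPzRingType) (R : comAlgType K) (I : idealr R).
Notation Q := {ideal_quot I}.

(* The quotient ring of the library only has a ring structure; the scalars act
   through the structure morphism K -> R -> R/I, see [pi_scale]. *)
Definition quot_scale (c : K) (x : Q) : Q := \pi_Q (c%:A) * x.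

Fact quot_scaleA a b x : quot_scale a (quot_scale b x) = quot_scale (a * b) x.
Proof. by rewrite /quot_scale mulrA -rmorphM /= -scalerAl mul1r scalerA. Qed.
Fact quot_scale1 : left_id 1 quot_scale.
Proof. by move=> x; rewrite /quot_scale scale1r rmorph1 mul1r. Qed.
Fact quot_scaleDr : right_distributive quot_scale +%R.
Proof. by move=> a x y; rewrite /quot_scale mulrDr. Qed.
Fact quot_scaleDl x : {morph quot_scale^~ x : a b / a + b}.
Proof. by move=> a b; rewrite /quot_scale scalerDl rmorphD mulrDl. Qed.

HB.instance Definition _ := GRing.Zmodule_isLmodule.Build K Q
  quot_scaleA quot_scale1 quot_scaleDr quot_scaleDl.

Fact quot_scaleAl (c : K) (x y : Q) : c *: (x * y) = (c *: x) * y.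
Proof. exact: mulrA. Qed.
HB.instance Definition _ := GRing.LSemiModule_isLSemiAlgebra.Build K Q quot_scaleAl.

Fact quot_scaleAr (c : K) (x y : Q) : c *: (x * y) = x * (c *: y).
Proof. exact: mulrCA. Qed.
HB.instance Definition _ := GRing.LSemiAlgebra_isSemiAlgebra.Build K Q quot_scaleAr.

Lemma pi_scale (c : K) (p : R) : c *: \pi_Q p = \pi_Q (c *: p).
Proof. by rewrite -[c *: p]mulr_algl rmorphM. Qed.

End QuotientAlgebra.

Record central_arrangement (K : fieldType) := CentralArrangement {
  nlines : nat;
  nlines_gt0 : (0 < nlines)%N;
  line : 'I_nlines -> {vspace 'rV[K]_2};
  dim_line : forall i, \dim (line i) = 1%N;
  line_inj : injective line;
  line_form : 'I_nlines -> {mpoly K[2]};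
  line_form_homog : forall i, line_form i \is 1.-homog;
  line_formP : forall i (v : 'rV[K]_2),
    (v \in line i) = ((line_form i).@[v 0] == 0)
}.

Section DefiningIdeal.
Variables (K : fieldType) (A : central_arrangement K).

Definition defining_poly : {mpoly K[2]} := \prod_(i < nlines A) line_form i.

Definition defining_ideal : {pred {mpoly K[2]}} :=
  fun f => `[< exists g, f = defining_poly * g >].

Fact defining_poly0 : defining_poly.@[(0 : 'rV[K]_2) 0] = 0.
Proof.
rewrite rmorph_prod (bigD1 (Ordinal (nlines_gt0 A))) //=.
have := mem0v (line (Ordinal (nlines_gt0 A))).
by rewrite line_formP => /eqP->; rewrite mul0r.
Qed.

Fact defining_ideal_closed : idealr_closed defining_ideal.
Proof.
split.
- by apply/asboolP; exists 0; rewrite mulr0.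
- apply/asboolP => -[g /(congr1 (meval ((0 : 'rV[K]_2) 0)))].
  by rewrite rmorph1 rmorphM /= defining_poly0 mul0r => /eqP; rewrite oner_eq0.
- move=> a _ _ /asboolP[g ->] /asboolP[h ->]; apply/asboolP.
  by exists (a * g + h); rewrite mulrDr mulrCA.
Qed.

HB.instance Definition _ :=
  isIdealr.Build {mpoly K[2]} defining_ideal defining_ideal_closed.

End DefiningIdeal.

Arguments defining_ideal {K} A.

(* Main.v *)
From HB Require Import structures.
Require Import Defs.
From mathcomp Require Import all_boot all_algebra.
From mathcomp Require Import boolp classical_sets.
From mathcomp Require Import mpoly ring.

Set Implicit Arguments.
Unset Strict Implicit.
Unset Printing Implicit Defensive.

Import GRing.Theory.
Local Open Scope ring_scope.

(** Choose a linear form that vanishes on none of the lines and use it as the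
  parameter [t] of each of them.  Restriction to the lines embeds [R = S / QS]
  into the product of [r] copies of [K[t]], and the conductor of this embedding
  is generated by [t ^ m] with [m = r - 1], because the product of the equations
  of the other lines restricts to a nonzero multiple of [t ^ m] on each line
  ([arrangement_branches]).

  A differential operator on [R] preserves the kernel of each restriction
  ([pi_diffop_kernel]), so [D(R)] embeds into the product [A] of [r] copies of
  the Weyl algebra [B = D(K[t])].  The image [D] consists of operators that map
  the conductor to itself, and it contains the right ideal [t ^ m A] of [A],
  since such operators map the product of the [K[t]] into the conductor, hence
  into [R].  So [D] lies between [t ^ m A] and its idealizer, and
  [D / t ^ m A] acts faithfully on the product of the algebras [K[t] / t ^ m]:
  it is finite-dimensional ([branch_coef0]).

  Such a ring is left Noetherian ([left_coord_noetherian]).  A left ideal [L]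
  of [D] generates a left ideal [N] of [A], and [t ^ m N] is contained in [L].
  Since [A] is left Noetherian, [N] is constant from some point on in a chain of
  left ideals, which then lives in [(D `&` N) / t ^ m N].  The quotient of
  this space by the image of [t ^ m A `&` N] is finite-dimensional because
  [D / t ^ m A] is, and that image is isomorphic to the kernel of [t ^ m] on
  [A / N], whose chains of subspaces are stationary too ([acc_weyl_kernelX]).
  The last point is Kashiwara's argument: over the Weyl algebra the kernel [U] of
  [t] on a module generates a submodule [U[d]] in which [U] is again the
  kernel of [t], so an infinite chain of subspaces of [U] would contradict the
  Noetherian property of [A / N].

  The right-hand case is the left-hand case for the converse rings.  The converse
  of the Weyl algebra is a Weyl algebra with [- d] in place of [d], and the
  action of [D] on the normalization is exchanged with its action on the
  conductor: if [theta] acts on a branch by [iota theta] and on the conductor,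
  identified with [K[t]] by division by [t ^ m], by [lambda theta], then for the
  operator [j b] that is [t ^ m b] on this branch and zero on the others,
  [j b * theta = j (b * iota theta)] and [theta * j b = j (lambda theta * b)]. *)

(** * Chains of subspaces *)

Lemma chain_le (T : Type) (J : nat -> set T) :
  (forall n, (J n `<=` J n.+1)%classic) ->
  forall m n, (m <= n)%N -> (J m `<=` J n)%classic.
Proof.
move=> incJ m n /subnK <-; elim: (n - m)%N => [//|k IHk] x Jx.
by rewrite addSn; apply/incJ/IHk.
Qed.

Lemma stationaryP (T : Type) (J : nat -> set T) :
  (forall n, (J n `<=` J n.+1)%classic) ->
  stationary J <-> exists n, forall k, (J k `<=` J n)%classic.
Proof.
move=> incJ; split=> -[n Jn]; exists n => k.
  case: (leqP n k) => [/Jn -> //|/ltnW]; exact: chain_le.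
by move=> le_nk; apply/seteqP; split; [apply: Jn | apply: chain_le].
Qed.

Lemma uniform_stationary (I : finType) (T : Type) (J : I -> nat -> set T) :
  (forall i, stationary (J i)) ->
  exists n, forall m, (n <= m)%N -> forall i, J i m = J i n.
Proof.
move=> /choice[N statJ]; exists (\max_i N i) => m le_m i.
have leN : (N i <= \max_i N i)%N by apply: leq_bigmax.
by rewrite (statJ i m (leq_trans leN le_m)) (statJ i _ leN).
Qed.

(** Scalars act through left multiplication by [kap k], so that every left ideal
  is a subspace, whichever of a ring and its converse is considered. *)
Record subspace (K : Type) (T : pzRingType) (kap : K -> T) (W : set T) : Prop :=
  Subspace {
    subspace0 : W 0;
    subspaceB : forall x y, W x -> W y -> W (x - y);
    subspaceZ : forall k x, W x -> W (kap k * x)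
  }.

Definition acc_between (K : Type) (T : pzRingType) (kap : K -> T)
    (M N : set T) : Prop :=
  forall W : nat -> set T, (forall n, subspace kap (W n)) ->
    (forall n, (W n `<=` W n.+1)%classic) ->
    (forall n, (M `<=` W n)%classic) -> (forall n, (W n `<=` N)%classic) ->
    stationary W.

Section Subspaces.
Variables (K : Type) (T : pzRingType) (kap : K -> T).
Implicit Types (M N P W : set T).
Local Notation subspace := (subspace kap).
Local Notation acc_between := (acc_between kap).

Lemma subspaceN W x : subspace W -> W x -> W (- x).
Proof. by move=> sW Wx; rewrite -sub0r; apply: (subspaceB sW) => //; case: sW. Qed.

Lemma subspaceD W x y : subspace W -> W x -> W y -> W (x + y).
Proof.
by move=> sW Wx Wy; rewrite -[y]opprK; apply: (subspaceB sW) => //; apply: subspaceN.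
Qed.

Lemma subspaceMn W n x : subspace W -> W x -> W (x *+ n).
Proof.
move=> sW Wx; elim: n => [|n IHn]; first exact: subspace0 sW.
by rewrite mulrS; apply: (subspaceD sW).
Qed.

Lemma subspace_sum W (I : Type) (r : seq I) (Q : pred I) (F : I -> T) :
  subspace W -> (forall i, Q i -> W (F i)) -> W (\sum_(i <- r | Q i) F i).
Proof.
move=> sW WF; apply: big_ind => //; first exact: subspace0 sW.
by move=> x y; apply: subspaceD.
Qed.

Lemma subspaceI M N : subspace M -> subspace N -> subspace (M `&` N)%classic.
Proof.
move=> [M0 MB MZ] [N0 NB NZ]; split=> //.
  by move=> x y [Mx Nx] [My Ny]; split; [apply: MB|apply: NB].
by move=> k x [Mx Nx]; split; [apply: MZ|apply: NZ].
Qed.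

Definition addset M N : set T := fun x => exists u v, [/\ M u, N v & x = u + v].

Lemma subspace_add M N : subspace M -> subspace N -> subspace (addset M N).
Proof.
move=> [M0 MB MZ] [N0 NB NZ]; split.
- by exists 0, 0; split; rewrite ?addr0.
- move=> _ _ [u [v [Mu Nv ->]]] [u' [v' [Mu' Nv' ->]]].
  by exists (u - u'), (v - v'); split; [exact: MB|exact: NB|rewrite opprD addrACA].
- move=> k _ [u [v [Mu Nv ->]]]; exists (kap k * u), (kap k * v).
  by split; [exact: MZ|exact: NZ|rewrite mulrDr].
Qed.

Lemma left_ideal_subspace M : left_ideal M -> subspace M.
Proof.
move=> [M0 MD MM]; split=> [//|x y Mx My|k x /MM//].
by apply: MD => //; rewrite -mulN1r; apply: MM.
Qed.

Lemma acc_refl M : acc_between M M.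
Proof.
by move=> W _ incW MW WM; apply/stationaryP => //; exists 0%N => k x /WM/MW.
Qed.

Lemma acc_subset M M' N :
  (M `<=` M')%classic -> acc_between M N -> acc_between M' N.
Proof.
by move=> MM' accM W sW incW MW; apply: accM => // n x Mx; apply/MW/MM'.
Qed.

(** By the modular law, a chain is stationary as soon as its intersection with
  [P] and its sum with [P] are. *)
Lemma acc_trans M P N : subspace P -> subspace N ->
  (M `<=` P)%classic -> (P `<=` N)%classic ->
  acc_between M P -> acc_between P N -> acc_between M N.
Proof.
move=> sP sN MP PN accMP accPN W sW incW MW WN.
have [n0 capW] : exists n, forall k,
    (W k `&` P `<=` W n `&` P)%classic.
  apply/(stationaryP (J := fun n => W n `&` P)%classic).
    by move=> n x [/incW].
  apply: accMP => [n|n x [/incW] //|n x Mx|n x [] //]; first exact: subspaceI.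
  by split; [apply: MW|apply: MP].
have incS n : (addset (W n) P `<=` addset (W n.+1) P)%classic.
  by move=> x [u [v [/incW Wu Pv ->]]]; exists u, v.
have [n1 addW] : exists n, forall k,
    (addset (W k) P `<=` addset (W n) P)%classic.
  apply/(stationaryP incS); apply: accPN => // [n|n x Px|n x [u [v [Wu Pv ->]]]].
  - exact: subspace_add.
  - by exists 0, x; split=> //; [case: (sW n) | rewrite add0r].
  - by apply: (subspaceD sN); [apply: WN Wu | apply: PN].
apply/stationaryP => //; exists (maxn n0 n1) => k x Wx.
have [|u [v [Wu Pv def_x]]] := addW k x.
  by exists x, 0; split; rewrite ?addr0 //; case: sP.
have WuM := chain_le incW (leq_maxr n0 n1) Wu.
rewrite def_x; apply: (subspaceD (sW _)) => //.
apply: (chain_le incW (leq_maxl n0 n1)).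
suff [] : (W n0 `&` P)%classic v by [].
apply: (capW (maxn k n1)); split=> //.
have -> : v = x - u by rewrite def_x addrC addKr.
apply: (subspaceB (sW _)); first exact: chain_le (leq_maxl k n1) _ Wx.
exact: chain_le (leq_maxr k n1) _ Wu.
Qed.

End Subspaces.

(** A subspace [W] that contains the preimage of [N] is determined by
  [g W + N]. *)
Lemma acc_preim (K : Type) (T : pzRingType) (kap : K -> T) (g : T -> T)
    (M N : set T) :
  (forall x y, g (x - y) = g x - g y) ->
  (forall k x, g (kap k * x) = kap k * g x) ->
  subspace kap N -> subspace kap M -> (N `<=` M)%classic ->
  acc_between kap N M ->
  acc_between kap (fun x => N (g x)) (fun x => M (g x)).
Proof.
move=> gB gZ sN sM NM accNM W sW incW NW WM.
have g0 : g 0 = 0 by have := gB 0 0; rewrite !subrr.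
pose gW n : set T := fun y => exists2 x, W n x & y = g x.
have sgW n : subspace kap (gW n).
  have [W0 WB WZ] := sW n; split; first by exists 0.
    by move=> _ _ [x Wx ->] [y Wy ->]; exists (x - y); [exact: WB|].
  by move=> k _ [x Wx ->]; exists (kap k * x); [exact: WZ|].
have incG n : (addset (gW n) N `<=` addset (gW n.+1) N)%classic.
  move=> y [u [v [[x /incW Wx ->] Nv ->]]].
  by exists (g x), v; split=> //; exists x.
have [n1 addW] : exists n, forall k,
    (addset (gW k) N `<=` addset (gW n) N)%classic.
  apply/(stationaryP incG); apply: accNM => // [n|n x Nx|n y].
  - exact: subspace_add.
  - by exists 0, x; split; rewrite ?add0r //; case: (sgW n).
  - move=> [_ [v [[x /WM Wx ->] Nv ->]]]; apply: (subspaceD sM) => //.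
    exact: NM.
apply/stationaryP => //; exists n1 => k x Wx.
have [|_ [v [[y Wy ->] Nv def_v]]] := addW k (g x).
  by exists (g x), 0; split; rewrite ?addr0 //; [exists x | case: sN].
rewrite -(subrK y x); apply: (subspaceD (sW n1)) => //.
by apply: NW; rewrite gB def_v addrC addKr.
Qed.

(** A finite set of linear functionals cuts out a subspace of finite
  codimension. *)
Lemma acc_functionals (K : fieldType) (T : pzRingType) (kap : K -> T)
    (Idx : finType) (f : Idx -> T -> K) (N : set T) :
  (forall s x y, f s (x - y) = f s x - f s y) ->
  (forall s k x, f s (kap k * x) = k * f s x) ->
  subspace kap N ->
  acc_between kap (fun x => N x /\ forall s, f s x = 0) N.
Proof.
move=> fB fZ sN.
suff acc_seq (s : seq Idx) :
    acc_between kap (fun x => N x /\ forall i, i \in s -> f i x = 0) N.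
  apply: (acc_subset _ (acc_seq (enum Idx))) => x [Nx fx]; split=> // i.
  by apply: fx; rewrite mem_enum.
elim: s => [|i s IHs]; first by apply: (acc_subset _ (@acc_refl _ _ _ _)) => x Nx.
have f0 j : f j 0 = 0 by have := fB j 0 0; rewrite !subrr.
have sS : subspace kap (fun x => N x /\ forall j, j \in s -> f j x = 0).
  case: sN => N0 NB NZ; split; first by split.
    move=> x y [Nx fx] [Ny fy]; split; first exact: NB.
    by move=> j sj; rewrite fB fx // fy // subrr.
  move=> k x [Nx fx]; split; first exact: NZ.
  by move=> j sj; rewrite fZ fx // mulr0.
apply: (acc_trans sS sN _ _ _ IHs).
- by move=> x [Nx fx]; split=> // j sj; apply: fx; rewrite inE sj orbT.
- by move=> x [].
move=> W sW incW MW WN; apply/stationaryP => //.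
(* An element of the chain outside the kernel spans the whole quotient. *)
case: (pselect (exists n x, W n x /\ f i x != 0)) => [[n [x [Wx fx]]]|nW].
  exists n => k y /WN[Ny fy]; have [Nx fxs] := WN _ _ Wx.
  pose c := f i y / f i x.
  rewrite -(subrK (kap c * x) y); apply: (subspaceD (sW n)); last first.
    exact: (subspaceZ (sW n)).
  apply: MW; split.
    by apply: (subspaceB sN); last exact: (subspaceZ sN).
  move=> j; rewrite inE => /predU1P[->|sj].
    by rewrite fB fZ divfK // subrr.
  by rewrite fB fZ fy // fxs // mulr0 subrr.
exists 0%N => k x Wx; have [Nx fx] := WN _ _ Wx; apply: MW; split=> // j.
rewrite inE => /predU1P[->|/fx//].
by apply/eqP/negPn/negP => fix0; apply: nW; exists k, x.
Qed.

Section SumOfImages.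
Variables (K : Type) (B D : pzRingType) (kapB : K -> B) (kapD : K -> D).
Variables (I : finType) (j : I -> B -> D).
Hypothesis jB : forall i b b', j i (b - b') = j i b - j i b'.
Hypothesis jZ : forall i k b, j i (kapB k * b) = kapD k * j i b.

Definition sum_images (Y : I -> set B) : set D :=
  fun x => exists b : I -> B, (forall i, Y i (b i)) /\ x = \sum_i j i (b i).

Lemma sum_images_subspace Y :
  (forall i, subspace kapB (Y i)) -> subspace kapD (sum_images Y).
Proof.
move=> sY; have j0 i : j i 0 = 0 by have := jB i 0 0; rewrite !subrr.
split.
- exists (fun=> 0); split=> [i|]; first by case: (sY i).
  by rewrite big1.
- move=> _ _ [b [Yb ->]] [b' [Yb' ->]]; exists (fun i => b i - b' i).
  split=> [i|]; first by case: (sY i) => _ sub _; apply: sub.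
  by rewrite -sumrB; apply: eq_bigr.
- move=> k _ [b [Yb ->]]; exists (fun i => kapB k * b i).
  split=> [i|]; first by case: (sY i) => _ _ sZ; apply: sZ.
  by rewrite mulr_sumr; apply: eq_bigr.
Qed.

(** The summands are enlarged from [N i] to [M i] one at a time; a subspace
  between two successive sums is determined by its preimage under [j i]. *)
Lemma acc_sum_images (N M : I -> set B) :
  (forall i, subspace kapB (N i)) -> (forall i, subspace kapB (M i)) ->
  (forall i, (N i `<=` M i)%classic) ->
  (forall i, acc_between kapB (N i) (M i)) ->
  acc_between kapD (sum_images N) (sum_images M).
Proof.
move=> sN sM NM accNM.
have j0 i : j i 0 = 0 by have := jB i 0 0; rewrite !subrr.
pose Y (s : seq I) i : set B := if i \in s then M i else N i.
have sY s i : subspace kapB (Y s i) by rewrite /Y; case: ifP.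
have NY s i : (N i `<=` Y s i)%classic.
  by rewrite /Y; case: ifP => _ x //; apply: NM.
have YM s i : (Y s i `<=` M i)%classic.
  by rewrite /Y; case: ifP => _ x //; apply: NM.
suff acc_seq s : acc_between kapD (sum_images N) (sum_images (Y s)).
  have <- : Y (enum I) = M by apply: funext => i; rewrite /Y mem_enum.
  exact: acc_seq.
elim: s => [|i s IHs].
  have -> : Y [::] = N by apply: funext => i; rewrite /Y.
  exact: acc_refl.
have YS k : (Y s k `<=` Y (i :: s) k)%classic.
  rewrite /Y inE; case: (k \in s); first by rewrite orbT.
  by rewrite orbF; case: eqP => _ x //; apply: NM.
apply: (acc_trans _ _ _ _ IHs); try exact: sum_images_subspace.
- by move=> _ [b [Nb ->]]; exists b; split=> // k; apply: NY.
- by move=> _ [b [Yb ->]]; exists b; split=> // k; apply: YS.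
move=> W sW incW YW WY.
pose V n : set B := fun b => M i b /\ W n (j i b).
have [n statV] : exists n, forall k, (V k `<=` V n)%classic.
  have incV n : (V n `<=` V n.+1)%classic by move=> b [Mb /incW].
  apply/(stationaryP incV); apply: (accNM i) => // [n|n b Nb|n b []//].
    have [M0 MB MZ] := sM i; have [W0 WB WZ] := sW n; split.
    - by rewrite /V j0.
    - by move=> b b' [Mb Wb] [Mb' Wb']; split; [exact: MB|rewrite jB; exact: WB].
    - by move=> k b [Mb Wb]; split; [exact: MZ|rewrite jZ; exact: WZ].
  split; first exact: NM.
  apply: YW; exists (fun k => if k == i then b else 0); split=> [k|].
    case: eqP => [->|_]; first exact: NY.
    by case: (sY s k).
  rewrite (bigD1 i) //= eqxx big1 ?addr0 // => k /negPf->; exact: j0.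
apply/stationaryP => //; exists n => k x Wx.
have [b [Yb def_x]] := WY k x Wx.
pose rest := \sum_(l | l != i) j l (b l).
have def_x' : x = j i (b i) + rest by rewrite def_x (bigD1 i).
have Yrest : sum_images (Y s) rest.
  exists (fun l => if l == i then 0 else b l); split=> [l|].
    have := Yb l; rewrite /Y inE; case: eqP => //= _ _.
    by case: ifP => _; [case: (sM l)|case: (sN l)].
  rewrite [RHS](bigD1 i) //= eqxx j0 add0r; apply: eq_bigr => l /negPf->//.
rewrite def_x'; apply: (subspaceD (sW n)); last exact: YW.
suff [] : V n (b i) by [].
apply: (statV k); split; first exact: YM (Yb i).
have -> : j i (b i) = x - rest by rewrite def_x' addrK.
by apply: (subspaceB (sW k)) => //; apply: YW.
Qed.

End SumOfImages.

(** * Subrings of finite codimension in an idealizer *)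

(** [left_coord] records one half of a two-sided situation: [D] is a ring of
  operators with coordinates [iota i : D -> B], and [j i] embeds the copy of
  [c * B] supported in the [i]-th coordinate into [D].  The functionals [f]
  say that these copies together have finite codimension in [D].  The other
  half is the same record for the converse rings. *)
Record left_coord (K : fieldType) (B D : pzRingType) (kapB : K -> B)
    (kapD : K -> D) (I Idx : finType) (c : B) (iota : I -> D -> B)
    (j : I -> B -> D) (f : Idx -> D -> K) : Prop := LeftCoord {
  coord_iotaB : forall i x y, iota i (x - y) = iota i x - iota i y;
  coord_iotaM : forall i a x, iota i (a * x) = iota i a * iota i x;
  coord_jB : forall i b b', j i (b - b') = j i b - j i b';
  coord_jZ : forall i k b, j i (kapB k * b) = kapD k * j i b;
  coord_jM : forall i b x, j i b * x = j i (b * iota i x);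
  coord_iotaj : forall i l b, iota l (j i b) = if l == i then c * b else 0;
  coord_fB : forall s x y, f s (x - y) = f s x - f s y;
  coord_fZ : forall s k x, f s (kapD k * x) = k * f s x;
  coord_f0 : forall x, (forall s, f s x = 0) ->
    exists b : I -> B, x = \sum_i j i (b i)
}.

(** A left ideal [L] of [D] has coordinate ideals [N i], left ideals of [B],
  and is squeezed between the sum of the [j i (N i)] and the elements with all
  coordinates in [N i].  Once the [N i] are stationary, only this gap matters,
  and it has finite length: an element on which the functionals vanish is a
  sum of [j i (b i)], and then its coordinates lie in [N i] exactly when
  [c * b i] does. *)
Lemma left_coord_noetherian (K : fieldType) (B D : pzRingType) (kapB : K -> B)
    (kapD : K -> D) (I Idx : finType) (c : B) (iota : I -> D -> B)
    (j : I -> B -> D) (f : Idx -> D -> K) :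
  left_coord kapB kapD c iota j f ->
  (forall k, kapB k * c = c * kapB k) ->
  left_noetherian B ->
  (forall N : set B, left_ideal N -> acc_between kapB N (fun b => N (c * b))) ->
  left_noetherian D.
Proof.
move=> [iB iM jB jZ jM ij fB fZ f0] cZ noethB accB L idL incL.
have j0 i : j i 0 = 0 by have := jB i 0 0; rewrite !subrr.
have i0 i : iota i 0 = 0 by have := iB i 0 0; rewrite !subrr.
have jD i b b' : j i (b + b') = j i b + j i b'.
  by apply: (addIr (- j i b')); rewrite addrK -jB addrK.
have iD i x y : iota i (x + y) = iota i x + iota i y.
  by apply: (addIr (- iota i y)); rewrite addrK -iB addrK.
have isum i (F : I -> D) : iota i (\sum_l F l) = \sum_l iota i (F l).
  by elim/big_rec2: _ => [|l y x _ <-]; rewrite ?i0 ?iD.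
(* The largest left ideal of [B] that [j i] maps into [L n]. *)
pose N i n : set B := fun b => forall a, L n (j i (a * b)).
have idN i n : left_ideal (N i n).
  have [L0 LD LM] := idL n; split.
  - by move=> a; rewrite mulr0 j0.
  - by move=> b b' Nb Nb' a; rewrite mulrDr jD; apply: LD.
  - by move=> a b Nb a'; rewrite mulrA.
have iotaN i n x : L n x -> N i n (iota i x).
  by move=> Lx a; rewrite -jM; case: (idL n) => _ _; apply.
have jN i n b : N i n b -> L n (j i b) by move=> /(_ 1); rewrite mul1r.
have [i|n0 statN] := @uniform_stationary I B N.
  by apply: noethB => // n b Nb a; apply/incL/Nb.
pose M i : set B := fun b => N i n0 (c * b).
have sN i : subspace kapB (N i n0) by apply/left_ideal_subspace/idN.
have sM i : subspace kapB (M i).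
  have [N0 NB NZ] := sN i; split; rewrite /M ?mulr0 //.
    by move=> x y Mx My; rewrite mulrBr; apply: NB.
  by move=> k x Mx; rewrite mulrA -cZ -mulrA; apply: NZ.
have NM i : (N i n0 `<=` M i)%classic.
  by move=> b Nb; apply: (left_idealM (idN i n0)).
pose top : set D := fun x => forall i, N i n0 (iota i x).
have sTop : subspace kapD top.
  split=> [i|x y tx ty i|k x tx i]; rewrite ?i0 ?iB ?iM.
  - exact: left_ideal0 (idN i n0).
  - by apply: (subspaceB (sN i)).
  - exact: left_idealM (idN i n0) _ _ (tx i).
have sumM_top : (sum_images j M `<=` top)%classic.
  move=> _ [b [Mb ->]] i; rewrite isum (bigD1 i) //= big1 => [|l neq_l].
    by rewrite ij eqxx addr0; apply: Mb.
  by rewrite ij eq_sym (negPf neq_l).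
have acc_top : acc_between kapD (sum_images j (N^~ n0)) top.
  apply: (acc_trans (P := sum_images j M)) => //.
  - exact: sum_images_subspace.
  - by move=> _ [b [Nb ->]]; exists b; split=> // i; apply: NM.
  - by apply: acc_sum_images => // i; apply: accB.
  apply: (acc_subset _ (acc_functionals fB fZ sTop)) => x [tx fx].
  have [b def_x] := f0 _ fx; exists b; split=> // i; rewrite /M.
  have := tx i; rewrite def_x isum (bigD1 i) //= big1 => [|l neq_l].
    by rewrite ij eqxx addr0.
  by rewrite ij eq_sym (negPf neq_l).
apply/(stationaryP incL).
have [||||n statL] := acc_top (fun n => L (n0 + n)%N).
- by move=> n; apply: left_ideal_subspace.
- by move=> n; rewrite addnS; apply: incL.
- move=> n _ [b [Nb ->]].
  have sL := left_ideal_subspace kapD (idL (n0 + n)%N).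
  apply: (subspace_sum _ sL) => i _; apply: jN.
  by rewrite (statN _ (leq_addr n n0)); apply: Nb.
- by move=> n x Lx i; rewrite -(statN _ (leq_addr n n0)); apply: iotaN.
exists (n0 + n)%N => k x Lx; rewrite -(statL (n + k)%N (leq_addr _ _)).
by apply: chain_le Lx => //; rewrite addnA leq_addl.
Qed.

(** * The Weyl algebra in one variable *)

Lemma natr_neq0 (K : fieldType) n : [pchar K] =i pred0 -> n.+1%:R != 0 :> K.
Proof. by move=> /pcharf0P->. Qed.

Lemma left_noetherian_poly (K : fieldType) : left_noetherian {poly K}.
Proof.
move=> J idJ incJ; apply/(stationaryP incJ).
case: (pselect (exists n p, J n p /\ p != 0)) => [exJ|zeroJ]; last first.
  exists 0%N => k p Jp; case: (eqVneq p 0) => [->|p0]; first by case: (idJ 0%N).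
  by case: zeroJ; exists k, p.
have exsz : exists s, `[< exists n p, [/\ J n p, p != 0 & size p = s] >].
  by have [n [p [Jp p0]]] := exJ; exists (size p); apply/asboolP; exists n, p.
case: (ex_minnP exsz) => s /asboolP[n [p [Jp p0 szp]]] min_s.
exists n => k q Jq; have [_ JD JM] := idJ (maxn n k).
have Jr : J (maxn n k) (q %% p).
  rewrite (_ : q %% p = q + - (q %/ p) * p).
    apply: JD; first exact: chain_le (leq_maxr n k) _ Jq.
    by apply: JM; apply: chain_le (leq_maxl n k) _ Jp.
  by rewrite {2}(divp_eq q p) mulNr addrC addKr.
have /modp_eq0P/divpK <- : q %% p = 0.
  apply/eqP/negPn/negP => r0.
  have : (s <= size (q %% p)%R)%N.
    by apply: min_s; apply/asboolP; exists (maxn n k), (q %% p)%R.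
  by rewrite leqNgt -szp ltn_modp p0.
exact: left_idealM.
Qed.

(** Stationarity on the diagonal settles all large indices, and leaves finitely
  many rows. *)
Lemma double_stationary (T : Type) (G : nat -> nat -> set T) :
  (forall n m, (G n m `<=` G n.+1 m)%classic) ->
  (forall n m, (G n m `<=` G n m.+1)%classic) ->
  stationary (fun n => G n n) -> (forall m, stationary (G^~ m)) ->
  exists n, forall k m, (n <= k)%N -> G k m = G n m.
Proof.
move=> incn incm [n0 diag] rows.
have [n1 rowsE] := uniform_stationary
  (fun m : 'I_n0 => rows m).
have big k m : (n0 <= k)%N -> (n0 <= m)%N -> G k m = G n0 n0.
  move=> le_k le_m; apply/seteqP; split; last first.
    move=> x /(chain_le (incn^~ n0) le_k); exact: chain_le.
  rewrite -(diag (maxn k m)) => [x|]; last by rewrite leq_max le_k.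
  move=> /(chain_le (incn^~ m) (leq_maxl k m)).
  exact: chain_le (leq_maxr k m) _.
exists (maxn n0 n1) => k m; rewrite geq_max => /andP[le0 le1].
case: (ltnP m n0) => [lt_m|le_m].
  have E := fun j le => rowsE j le (Ordinal lt_m).
  by rewrite [LHS](E k le1) [RHS](E _ (leq_maxr _ _)).
by rewrite !big // leq_maxl.
Qed.

(** The features of the Weyl algebra [K[t]<d>] that are used below, phrased so
  that the converse ring has them as well, with [- d] in place of [d]. *)
Record weyl_like (K : fieldType) (B : pzRingType) (phi : {poly K} -> B)
    (d : B) : Prop := WeylLike {
  weyl_phiB : forall p q, phi (p - q) = phi p - phi q;
  weyl_phiM : forall p q, phi (p * q) = phi p * phi q;
  weyl_phi1 : phi 1 = 1;
  weyl_comm : d * phi 'X - phi 'X * d = 1;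
  weyl_central : forall k x, phi k%:P * x = x * phi k%:P;
  weyl_centralizer : forall x, x * phi 'X = phi 'X * x -> exists p, x = phi p;
  weyl_nilp : forall x, exists m,
    iter m (fun y => y * phi 'X - phi 'X * y) x = 0
}.

Section Weyl.
Variables (K : fieldType) (B : pzRingType) (phi : {poly K} -> B) (d : B).
Hypothesis charK : [pchar K] =i pred0.
Hypothesis weylB : weyl_like phi d.
Local Notation t := (phi 'X).
Local Notation kap := (fun k : K => phi k%:P).
Local Notation ad := (fun y => y * phi 'X - phi 'X * y).

Record weyl_submodule (W : set B) : Prop := WeylSubmodule {
  weyl_subspace : subspace kap W;
  weyl_subt : forall x, W x -> W (t * x);
  weyl_subd : forall x, W x -> W (d * x)
}.

Lemma left_ideal_weyl W : left_ideal W -> weyl_submodule W.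
Proof.
move=> idW; split; first exact: left_ideal_subspace.
  by move=> x; apply: left_idealM.
by move=> x; apply: left_idealM.
Qed.

Lemma phi0 : phi 0 = 0.
Proof. by have := weyl_phiB weylB 0 0; rewrite !subrr. Qed.

Lemma phiD p q : phi (p + q) = phi p + phi q.
Proof. by apply: (addIr (- phi q)); rewrite addrK -(weyl_phiB weylB) addrK. Qed.

Lemma phiMn p n : phi (p *+ n) = phi p *+ n.
Proof. by elim: n => [|n IHn]; rewrite ?phi0 // !mulrS phiD IHn. Qed.

Lemma phiC_natr n : phi n%:R%:P = n%:R.
Proof. by rewrite polyC_natr phiMn (weyl_phi1 weylB). Qed.

Lemma weyl_sub_phi W p x : weyl_submodule W -> W x -> W (phi p * x).
Proof.
move=> [sW Wt _] Wx; elim/poly_ind: p => [|p c IHp].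
  by rewrite phi0 mul0r; case: sW.
rewrite phiD mulrDl mulrC (weyl_phiM weylB) -mulrA.
by apply: (subspaceD sW); [apply: Wt | apply: (subspaceZ sW)].
Qed.

Lemma subspace_natr W n x : subspace kap W -> W (x *+ n.+1) -> W x.
Proof.
move=> sW Wx.
suff -> : x = kap n.+1%:R^-1 * (x *+ n.+1) by apply: subspaceZ sW _ _ Wx.
rewrite -(mulr_natl x) mulrA -phiC_natr -(weyl_phiM weylB) -polyCM.
by rewrite mulVf ?natr_neq0 // polyC1 (weyl_phi1 weylB) mul1r.
Qed.

Lemma adB x y : ad (x - y) = ad x - ad y.
Proof. by rewrite /= mulrBl mulrBr !opprD !opprK addrACA. Qed.

Lemma ad_iterB m x y : iter m ad (x - y) = iter m ad x - iter m ad y.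
Proof. by elim: m => //= m ->; apply: adB. Qed.

Lemma ad_iter0 m : iter m ad 0 = 0.
Proof. by have := ad_iterB m 0 0; rewrite !subrr. Qed.

Lemma ad_iterD m x y : iter m ad (x + y) = iter m ad x + iter m ad y.
Proof. by apply: (addIr (- iter m ad y)); rewrite addrK -ad_iterB addrK. Qed.

Lemma ad_iter_phi m p x : iter m ad (phi p * x) = phi p * iter m ad x.
Proof.
elim: m => //= m ->; rewrite mulrBr !mulrA; congr (_ - _ * _).
by rewrite -!(weyl_phiM weylB) mulrC.
Qed.

Lemma ad_iter_d m x :
  iter m.+1 ad (d * x) = d * iter m.+1 ad x + iter m ad x *+ m.+1.
Proof.
have ad_d y : ad (d * y) = d * ad y + y.
  transitivity (d * ad y + (d * t - t * d) * y).
    by rewrite /= mulrBl mulrBr !mulrA addrA subrK.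
  by rewrite (weyl_comm weylB) mul1r.
elim: m => [|m IHm]; first exact: ad_d.
have adD u v : ad (u + v) = ad u + ad v.
  by rewrite /= mulrDl mulrDr opprD addrACA.
have adMn u n : ad (u *+ n) = ad u *+ n.
  by rewrite /= mulrnAl mulrnAr mulrnBl.
rewrite iterS IHm adD ad_d -addrA; congr (_ + _).
by rewrite adMn [RHS]mulrS iterS.
Qed.

(** Hilbert's basis argument for the filtration by nilpotency order under [ad]:
  an element of order at most [m] has as symbol the polynomial representing its
  [m]-fold commutator with [t], and multiplication by [d] embeds the symbols of
  order [m] into those of order [m.+1] in characteristic zero. *)
Lemma weyl_noetherian (L : nat -> set B) :
  (forall n, weyl_submodule (L n)) -> (forall n, (L n `<=` L n.+1)%classic) ->
  stationary L.
Proof.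
move=> wL incL.
pose G n m : set {poly K} := fun p => exists2 x, L n x & phi p = iter m ad x.
have idG n m : left_ideal (G n m).
  have sL := weyl_subspace (wL n); split.
  - by exists 0; [case: sL | rewrite ad_iter0 phi0].
  - move=> p q [x Lx px] [y Ly qy]; exists (x + y); first exact: (subspaceD sL).
    by rewrite phiD px qy ad_iterD.
  - move=> p q [x Lx qx]; exists (phi p * x); first exact: weyl_sub_phi.
    by rewrite (weyl_phiM weylB) qx ad_iter_phi.
have incn n m : (G n m `<=` G n.+1 m)%classic.
  by move=> p [x /incL Lx px]; exists x.
have incm n m : (G n m `<=` G n m.+1)%classic.
  move=> p [x Lx px].
  have : G n m.+1 (p *+ m.+1).
    exists (d * x); first exact: weyl_subd (wL n) _ Lx.
    have adx0 : iter m.+1 ad x = 0.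
      by rewrite iterS -px -!(weyl_phiM weylB) mulrC subrr.
    by rewrite ad_iter_d adx0 mulr0 add0r -px phiMn.
  move=> /(left_idealM (idG n m.+1) (m.+1%:R^-1)%:P).
  rewrite -(mulr_natl p) mulrA -polyC_natr -polyCM mulVf ?natr_neq0 //.
  by rewrite polyC1 mul1r.
have noethK := @left_noetherian_poly K.
have [||n1 Gn1] := double_stationary incn incm.
- by apply: noethK => // n x Gx; apply/incn/incm.
- by move=> m; apply: noethK => // n; apply: incn.
apply/(stationaryP incL); exists n1 => k x Lx.
wlog le_k : k Lx / (n1 <= k)%N.
  move=> suff_k; case: (leqP n1 k) => [/(suff_k k Lx) //|/ltnW le_k].
  exact: chain_le le_k _ Lx.
have [m] := weyl_nilp weylB x; elim: m x Lx => [|m IHm] x Lx /= adx.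
  by rewrite adx; case: (weyl_subspace (wL n1)).
have [p def_p] := weyl_centralizer weylB (subr0_eq adx).
have [y Ly py] : G n1 m p by rewrite -(Gn1 k) //; exists x.
rewrite -(subrK y x); apply: (subspaceD (weyl_subspace (wL n1))) => //.
apply: IHm; last by rewrite ad_iterB def_p py subrr.
by apply: (subspaceB (weyl_subspace (wL k))) => //; apply: chain_le Ly.
Qed.

Lemma weyl_left_noetherian : left_noetherian B.
Proof.
by move=> J idJ; apply: weyl_noetherian => n; apply: left_ideal_weyl.
Qed.

Lemma weyl_t_dX i : t * d ^+ i.+1 = d ^+ i.+1 * t - d ^+ i *+ i.+1.
Proof.
have dt : t * d = d * t - 1 by rewrite -(weyl_comm weylB) subKr.
elim: i => [|i IHi]; first by rewrite !expr1 expr0 mulr1n.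
rewrite exprS mulrA dt mulrBl mul1r -mulrA IHi mulrBr mulrA -addrA.
congr (_ + _); rewrite -opprD [in RHS]mulrSr; congr (- (_ + _)).
by rewrite mulrnAr -exprS.
Qed.

Lemma weyl_sub_dX W i x : weyl_submodule W -> W x -> W (d ^+ i * x).
Proof.
move=> wW Wx; elim: i => [|i IHi]; first by rewrite expr0 mul1r.
by rewrite exprS -mulrA; apply: (weyl_subd wW).
Qed.

(** If [t] sends all [s i] into [N], then multiplication by [t] acts on
  [\sum_i d ^+ i * s i] modulo [N] as the derivative with respect to [d], up to
  sign. *)
Lemma weyl_kernel_derivative (N : set B) n (s : nat -> B) :
  weyl_submodule N -> (forall i, N (t * s i)) ->
  N (t * \sum_(i < n.+1) d ^+ i * s i) ->
  N (\sum_(i < n) d ^+ i * (s i.+1 *+ i.+1)).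
Proof.
move=> wN Ns; have sN := weyl_subspace wN.
rewrite mulr_sumr big_ord_recl expr0 mul1r /= => Nt.
have {Nt} := subspaceB sN Nt (Ns 0%N); rewrite addrC addKr => Nt.
have NdS : N (\sum_(l < n) d ^+ l.+1 * (t * s l.+1)).
  by apply: (subspace_sum _ sN) => l _; apply: weyl_sub_dX.
have := subspaceB sN NdS Nt; rewrite -sumrB; congr N.
apply: eq_bigr => l _; rewrite /= /bump /= add1n !mulrA weyl_t_dX.
by rewrite mulrBl opprB addrC subrK mulrnAl mulrnAr.
Qed.

Lemma weyl_kernel_free (N : set B) n (s : nat -> B) :
  weyl_submodule N -> (forall i, N (t * s i)) ->
  N (\sum_(i < n) d ^+ i * s i) -> forall i, (i < n)%N -> N (s i).
Proof.
move=> wN; have sN := weyl_subspace wN.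
elim: n s => [|n IHn] s Ns Nsum i //.
have pos k : (k < n)%N -> N (s k.+1).
  move=> lt_k; apply: (@subspace_natr _ k _ sN).
  apply: (IHn (fun k => s k.+1 *+ k.+1)) lt_k => [l|].
    by rewrite mulrnAr; apply: subspaceMn sN _; apply: Ns.
  by apply: (weyl_kernel_derivative wN Ns); apply: (weyl_subt wN).
case: i => [_|i lt_i]; last exact: pos.
have NdS : N (\sum_(l < n) d ^+ l.+1 * s l.+1).
  apply: (subspace_sum _ sN) => l _.
  exact: weyl_sub_dX wN (pos l (ltn_ord l)).
move: Nsum; rewrite big_ord_recl expr0 mul1r /= => Nsum.
by have := subspaceB sN Nsum NdS; rewrite addrK.
Qed.

(** Kashiwara's argument: the kernel of [t] on [B / N] generates a submodule in
  which it can be recovered as the kernel of [t], so chains of its subspaces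
  are as short as chains of submodules of [B / N]. *)
Lemma acc_weyl_kernel (N : set B) : left_ideal N ->
  acc_between kap N (fun b => N (t * b)).
Proof.
move=> idN W sW incW NW WN; have wN := left_ideal_weyl idN.
have sN := weyl_subspace wN.
pose L k : set B := fun x => exists n (s : nat -> B),
  (forall i, W k (s i)) /\ x = \sum_(i < n) d ^+ i * s i.
have pad n k (s : nat -> B) :
    \sum_(i < n) d ^+ i * s i =
    \sum_(i < n + k) d ^+ i * (if (i < n)%N then s i else 0).
  rewrite big_split_ord /= [X in _ + X]big1 ?addr0.
    by apply: eq_bigr => i _; rewrite /= ltn_ord.
  by move=> i _; rewrite /= ltnNge leq_addr mulr0.
have WL k x : W k x -> L k x.
  move=> Wx; exists 1%N, (fun=> x); split=> //.
  by rewrite big_ord1 expr0 mul1r.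
have sL k : subspace kap (L k).
  have W0 := subspace0 (sW k); split.
  - exact: WL.
  - move=> _ _ [n [s [Ws ->]]] [n' [s' [Ws' ->]]].
    exists (n + n')%N, (fun i => (if (i < n)%N then s i else 0) -
                                 (if (i < n')%N then s' i else 0)); split.
      by move=> i; apply: (subspaceB (sW k)); case: ifP.
    rewrite (pad n n') (pad n' n) addnC -sumrB addnC.
    by apply: eq_bigr => i _; rewrite mulrBr.
  - move=> c _ [n [s [Ws ->]]]; exists n, (fun i => kap c * s i); split.
      by move=> i; apply: (subspaceZ (sW k)).
    rewrite mulr_sumr; apply: eq_bigr => i _.
    by rewrite !mulrA (weyl_central weylB).
have Ld k x : L k x -> L k (d * x).
  move=> [n [s [Ws ->]]]; exists n.+1, (fun i => if i is i'.+1 then s i' else 0).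
  split=> [[|i] //|]; first by case: (sW k).
  rewrite big_ord_recl mulr0 add0r mulr_sumr; apply: eq_bigr => i _.
  by rewrite /= /bump /= add1n exprS mulrA.
have Ldi k i x : L k x -> L k (d ^+ i * x).
  move=> Lx; elim: i => [|i IHi]; first by rewrite expr0 mul1r.
  by rewrite exprS -mulrA; apply: Ld.
have Lt k x : L k x -> L k (t * x).
  move=> [n [s [Ws ->]]]; rewrite mulr_sumr.
  apply: (subspace_sum _ (sL k)) => -[i /= _] _.
  have Lts : L k (t * s i) by apply/WL/NW/(WN k).
  case: i Lts => [|i] Lts; first by rewrite expr0 mul1r.
  rewrite mulrA weyl_t_dX mulrBl -mulrA mulrnAl -mulrnAr.
  apply: (subspaceB (sL k)); first exact: Ldi.
  by apply/Ldi/WL/(subspaceMn _ (sW k)).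
have incL n : (L n `<=` L n.+1)%classic.
  by move=> x [m [s [Ws ->]]]; exists m, s; split=> // i; apply: incW.
have /(stationaryP incL)[n1 statL] := weyl_noetherian
  (fun k => WeylSubmodule (sL k) (@Lt k) (@Ld k)) incL.
apply/(stationaryP incW); exists n1 => k x Wx.
have [[|n] [s [Ws def_x]]] := statL k x (WL k x Wx).
  by rewrite def_x big_ord0; case: (sW n1).
have Ns i : N (t * s i) by apply: (WN n1).
have Nds : N (\sum_(i < n) d ^+ i * (s i.+1 *+ i.+1)).
  by apply: (weyl_kernel_derivative wN Ns); rewrite -def_x; apply: (WN k).
have pos i : (i < n)%N -> N (s i.+1).
  move=> lt_i; apply: (@subspace_natr _ i _ sN).
  apply: (weyl_kernel_free (s := fun i => s i.+1 *+ i.+1) wN _ Nds lt_i) => l.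
  by rewrite mulrnAr; apply: subspaceMn sN _; apply: Ns.
rewrite def_x big_ord_recl expr0 mul1r; apply: (subspaceD (sW n1)) => //.
apply: NW; apply: (subspace_sum _ sN) => i _.
exact: weyl_sub_dX wN (pos i (ltn_ord i)).
Qed.

(** Multiplication by [t ^ m] embeds the kernel of [t ^ m.+1], modulo that of
  [t ^ m], into the kernel of [t]. *)
Lemma acc_weyl_kernelX (N : set B) m : left_ideal N ->
  acc_between kap N (fun b => N (phi 'X^m * b)).
Proof.
move=> idN; elim: m => [|m IHm].
  rewrite expr0 (weyl_phi1 weylB).
  have -> : (fun b => N (1 * b)) = N by apply: funext => b; rewrite mul1r.
  exact: acc_refl.
have sN := weyl_subspace (left_ideal_weyl idN).
have phiMl p x y : phi p * (x - y) = phi p * x - phi p * y by rewrite mulrBr.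
have phiMZ p k x : phi p * (kap k * x) = kap k * (phi p * x).
  by rewrite !mulrA (weyl_central weylB).
have sNX p : subspace kap (fun b => N (phi p * b)).
  split=> [|x y Nx Ny|k x Nx]; rewrite ?mulr0; first by case: sN.
    by rewrite mulrBr; apply: (subspaceB sN).
  by rewrite phiMZ; apply: (subspaceZ sN).
have NNX p : (N `<=` (fun b => N (phi p * b)))%classic.
  by move=> b Nb; apply: (left_idealM idN).
apply: (acc_trans _ _ _ _ IHm) => //.
  move=> b Nb; rewrite exprS (weyl_phiM weylB) -mulrA.
  exact: left_idealM idN _ _ Nb.
have -> : (fun b => N (phi 'X^(m.+1) * b)) =
          (fun b => (fun b' => N (t * b')) (phi 'X^m * b)).
  by apply: funext => b; rewrite exprS (weyl_phiM weylB) mulrA.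
apply: (acc_preim (g := fun b => phi 'X^m * b) (M := fun b => N (t * b)) _ _ sN)
  => //; exact: acc_weyl_kernel.
Qed.

End Weyl.

Lemma weyl_like_converse (K : fieldType) (B : pzRingType)
    (phi : {poly K} -> B) (d : B) :
  weyl_like phi d -> weyl_like (B := B^c) phi (- d).
Proof.
move=> [pB pM p1 cd cc cC cn]; split=> //.
- by move=> p q; rewrite mulrC pM.
- by rewrite -[LHS]/(phi 'X * - d - - d * phi 'X) mulrN mulNr opprK addrC.
- by move=> k x; apply/esym/cc.
- by move=> x /esym/cC.
move=> x; have [m adx] := cn x; exists m.
suff : iter m (fun y : B => phi 'X * y - y * phi 'X) x =
       (-1) ^+ m * iter m (fun y : B => y * phi 'X - phi 'X * y) x.
  by rewrite adx mulr0.
elim: {adx} m => [|m IHm]; first by rewrite expr0 mul1r.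
rewrite iterS IHm iterS; set y := iter m _ x.
rewrite exprS mulN1r mulNr mulrBr opprB mulrA mulrA.
by congr (_ - _); rewrite ?mulrA // (commr_sign (phi 'X) m).
Qed.

(** * Differential operators on the affine line *)

Definition lin_map (K : comPzRingType) (U V : lmodType K) (f : U -> V)
    (lin_f : linear f) : {linear U -> V} :=
  HB.pack_for {linear U -> V} f (GRing.isLinear.Build K U V *:%R f lin_f).

Definition lin_kEnd (K : comPzRingType) (V : lmodType K) (f : V -> V)
    (lin_f : linear f) : kEnd V := lin_map lin_f.

Section DiffopLemmas.
Variables (K : comPzRingType) (R : comAlgType K).
Implicit Types (f g : kEnd R) (D : diffop K R).

Lemma diffop_eq D D' : (forall x, D x = D' x) -> D = D'.
Proof. by move=> eqD; apply/val_inj/kEnd_eq. Qed.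

Lemma diffop_leP D : exists m, diffop_le m (D : kEnd R).
Proof. by case: D => f /= /asboolP. Qed.

Lemma mulop_diffop_subproof (a : R) : mulop a \in @is_diffop K R.
Proof.
apply/asboolP; exists 0%N => b; apply: kEnd_eq => x.
by rewrite bracketE kEndE0 /= mulrCA subrr.
Qed.

Definition mul_diffop (a : R) : diffop K R := DiffOp (mulop_diffop_subproof a).

Lemma kEnd0 f : f 0 = 0.
Proof. exact: (linear0 (f : {linear R -> R})). Qed.

Lemma kEndB f x y : f (x - y) = f x - f y.
Proof. exact: (linearB (f : {linear R -> R})). Qed.

Lemma kEndD f x y : f (x + y) = f x + f y.
Proof. exact: (linearD (f : {linear R -> R})). Qed.

Lemma kEndZ f k x : f (k *: x) = k *: f x.
Proof. exact: (linearZZ (f : {linear R -> R})). Qed.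

End DiffopLemmas.

(** Conjugation by maps that intertwine the multiplications preserves the
  order; [alpha] and [beta] need not be mutually inverse. *)
Lemma diffop_le_conj (K : comPzRingType) (R R' : comAlgType K)
    (alpha : R -> R') (beta : R' -> R) (h : R' -> R) (D : kEnd R)
    (D' : kEnd R') n :
  (forall x y, alpha (x - y) = alpha x - alpha y) ->
  (forall a x, alpha (h a * x) = a * alpha x) ->
  (forall a y, beta (a * y) = h a * beta y) ->
  (forall y, D' y = alpha (D (beta y))) ->
  diffop_le n D -> diffop_le n D'.
Proof.
move=> alphaB alphaM betaM; elim: n D D' => [|n IHn] D D' D'E /= leD a.
  apply: kEnd_eq => y; rewrite bracketE !D'E betaM -alphaM -alphaB.
  by rewrite -bracketE leD kEndE0 -(subrr 0) alphaB subrr.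
apply: (IHn (bracket D (h a))) (leD (h a)) => y.
by rewrite !bracketE !D'E betaM alphaB alphaM.
Qed.

Lemma diffop_le_div (K : fieldType) (p : {poly K}) (D D' : kEnd {poly K}) n :
  p != 0 -> (forall q, D q = p * D' q) -> diffop_le n D -> diffop_le n D'.
Proof.
move=> p0; elim: n D D' => [|n IHn] D D' DE /= leD a.
  apply: kEnd_eq => q; rewrite bracketE kEndE0; apply: (mulfI p0).
  by rewrite mulr0 mulrBr mulrCA -!DE -bracketE leD kEndE0.
apply: (IHn (bracket D a)) (leD a) => q.
by rewrite !bracketE !DE mulrBr mulrCA.
Qed.

Section Line.
Variable K : fieldType.
Local Notation weyl := (diffop K {poly K}).

Lemma deriv_diffop_subproof :
  lin_kEnd (@deriv_is_linear K) \in @is_diffop K {poly K}.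
Proof.
apply/asboolP; exists 1%N => a b; apply: kEnd_eq => p.
rewrite bracketE kEndE0 !bracketE /= !derivM; ring.
Qed.

Definition deriv_diffop : weyl := DiffOp deriv_diffop_subproof.

Lemma weyl_like_diffop : weyl_like (@mul_diffop K {poly K}) deriv_diffop.
Proof.
split.
- by move=> p q; apply: diffop_eq => x; apply: mulrBl.
- by move=> p q; apply: diffop_eq => x; apply/esym/mulrA.
- by apply: diffop_eq => x; apply: mul1r.
- apply: diffop_eq => x.
  rewrite -[LHS]/(('X * x)^`() - 'X * x^`()) derivM derivX mul1r addrK.
  by [].
- move=> k D; apply: diffop_eq => x.
  rewrite -[LHS]/(k%:P * D x) -[RHS]/(D (k%:P * x)) !mul_polyC.
  by rewrite kEndZ.
- move=> D DX; exists (D 1); apply: diffop_eq => x.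
  have {}DX y : D ('X * y) = 'X * D y.
    exact: (congr1 (fun E : weyl => E y) DX).
  rewrite -[RHS]/(D 1 * x); elim/poly_ind: x => [|p c IHp].
    by rewrite mulr0 kEnd0.
  rewrite kEndD mulrC DX IHp -alg_polyC kEndZ mulrDr -scalerAr mulr1.
  by rewrite mulrCA.
- move=> D; have [m leD] := diffop_leP D; exists m.+1.
  elim: m D leD => [|m IHm] D leD; first exact/val_inj/leD.
  by rewrite iterSr; apply: IHm; apply: leD.
Qed.

End Line.

(** * Curves whose branches are affine lines *)

(** A reduced curve with coordinate ring [R], whose normalization is the
  disjoint union of affine lines indexed by [I], with structure maps [pi i].
  The parameter of all these lines is a single function [sigma 'X] on the curve,
  and ['X^m] generates the conductor. *)
Record line_branches (K : fieldType) (R : comAlgType K) (I : finType)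
    (pi : I -> {linear R -> {poly K}}) (sigma : {linear {poly K} -> R}) (w : I -> R) (m : nat) :
    Prop := LineBranches {
  piM : forall i x y, pi i (x * y) = pi i x * pi i y;
  sigmaM : forall p q, sigma (p * q) = sigma p * sigma q;
  pi_sigma : forall i p, pi i (sigma p) = p;
  pi_inj : forall x, (forall i, pi i x = 0) -> x = 0;
  pi_w : forall l i, pi l (w i) = if l == i then 'X^m else 0;
  conductor : forall i x, (forall l, l != i -> pi l x = 0) ->
    exists p, pi i x = 'X^m * p
}.

Section LineBranches.
Variables (K : fieldType) (R : comAlgType K) (I : finType).
Variables (pi : I -> {linear R -> {poly K}}) (sigma : {linear {poly K} -> R}) (w : I -> R).
Variable m : nat.
Hypothesis brR : line_branches pi sigma w m.
Local Notation weyl := (diffop K {poly K}).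
Implicit Types (D : diffop K R) (b : weyl).

Lemma pi_eq x y : (forall i, pi i x = pi i y) -> x = y.
Proof.
move=> eqxy; apply/subr0_eq/(pi_inj brR) => i.
by rewrite linearB eqxy subrr.
Qed.

Lemma mul_w i x : sigma (pi i x) * w i = x * w i.
Proof.
apply: pi_eq => l; rewrite !(piM brR) (pi_w brR) (pi_sigma brR).
by case: eqP => [->|_]; rewrite ?mulr0.
Qed.

(** The function [w i] annihilates the kernel of [pi i] without belonging to it.
  So for [x] in this kernel the commutator of [D] with [w i], which has smaller
  order than [D], maps [x] to [- (w i * D x)], and [pi i (w i)] can be
  cancelled. *)
Lemma pi_diffop_kernel i n (D : kEnd R) x :
  diffop_le n D -> pi i x = 0 -> pi i (D x) = 0.
Proof.
move=> leD pix.
have wx : w i * x = 0 by rewrite mulrC -mul_w pix linear0 mul0r.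
have Dw (E : kEnd R) : pi i (bracket E (w i) x) = - ('X^m * pi i (E x)).
  by rewrite bracketE wx kEnd0 sub0r linearN (piM brR) (pi_w brR) eqxx.
elim: n D leD => [|n IHn] D leD; move: (Dw D).
  rewrite leD kEndE0 linear0 => /esym/eqP.
  by rewrite oppr_eq0 mulf_eq0 expf_eq0 polyX_eq0 andbF => /eqP.
rewrite (IHn _ (leD (w i))) => /esym/eqP.
by rewrite oppr_eq0 mulf_eq0 expf_eq0 polyX_eq0 andbF => /eqP.
Qed.

(** By [pi_diffop_kernel], [D] induces an operator on each branch, which is
  computed on the lifts by [sigma]. *)
Lemma branch_op_subproof i D :
  exists f : weyl, forall p, f p = pi i (D (sigma p)).
Proof.
have lin_f : linear (fun p => pi i (D (sigma p))).
  by move=> k p q; rewrite linearP kEndD kEndZ linearP.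
have [n leD] := diffop_leP D.
have Pf : lin_kEnd lin_f \in @is_diffop K {poly K}.
  apply/asboolP; exists n.
  apply: (diffop_le_conj (alpha := pi i) (beta := sigma) (h := sigma)) leD => //.
  - by move=> x y; rewrite linearB.
  - by move=> p x; rewrite (piM brR) (pi_sigma brR).
  - by move=> p q; rewrite (sigmaM brR).
by exists (DiffOp Pf).
Qed.

Definition branch_op i D : weyl := projT1 (cid (branch_op_subproof i D)).

Lemma branch_op_sigma i D p : branch_op i D p = pi i (D (sigma p)).
Proof. exact: (projT2 (cid (branch_op_subproof i D))). Qed.

Lemma branch_opE i D x : pi i (D x) = branch_op i D (pi i x).
Proof.
rewrite branch_op_sigma; have [n leD] := diffop_leP D.
apply/subr0_eq; rewrite -linearB -kEndB; apply: pi_diffop_kernel leD _.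
by rewrite linearB (pi_sigma brR) subrr.
Qed.

Lemma pi_w_sigma l i p :
  pi l (w i * sigma p) = if l == i then 'X^m * p else 0.
Proof.
by rewrite (piM brR) (pi_w brR) (pi_sigma brR); case: eqP; rewrite ?mul0r.
Qed.

Lemma branch_op_conductor i D p : exists q, branch_op i D ('X^m * p) = 'X^m * q.
Proof.
have -> : 'X^m * p = pi i (w i * sigma p) by rewrite pi_w_sigma eqxx.
rewrite -branch_opE; apply: (conductor brR) => l neq_li.
by rewrite branch_opE pi_w_sigma (negPf neq_li) kEnd0.
Qed.

Lemma conductor_op_subproof i D :
  exists f : weyl, forall p, branch_op i D ('X^m * p) = 'X^m * f p.
Proof.
have [f fE] := choice (branch_op_conductor i D).
have Xm0 : 'X^m != 0 :> {poly K} by rewrite expf_eq0 polyX_eq0 andbF.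
have lin_f : linear f.
  move=> k p q; apply: (mulfI Xm0).
  by rewrite -fE mulrDr -scalerAr kEndD kEndZ !fE mulrDr -scalerAr.
have [n leD] := diffop_leP (branch_op i D * mul_diffop 'X^m).
have Pf : lin_kEnd lin_f \in @is_diffop K {poly K}.
  by apply/asboolP; exists n; apply: diffop_le_div Xm0 _ leD => p; rewrite -fE.
by exists (DiffOp Pf) => p; rewrite fE.
Qed.

(** The operator induced on the conductor ideal of the branch [i], identified
  with [K[t]] through division by ['X^m]. *)
Definition conductor_op i D : weyl := projT1 (cid (conductor_op_subproof i D)).

Lemma conductor_opE i D p :
  branch_op i D ('X^m * p) = 'X^m * conductor_op i D p.
Proof. exact: (projT2 (cid (conductor_op_subproof i D))). Qed.

Lemma extend_op_subproof i b :
  exists D : diffop K R, forall x, D x = w i * sigma (b (pi i x)).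
Proof.
have lin_f : linear (fun x => w i * sigma (b (pi i x))).
  move=> k x y; rewrite linearP kEndD kEndZ linearP mulrDr.
  by rewrite -scalerAr.
have [n leb] := diffop_leP b.
have Pf : lin_kEnd lin_f \in @is_diffop K R.
  apply/asboolP; exists n.
  apply: (diffop_le_conj (alpha := fun p => w i * sigma p) (beta := pi i)
    (h := pi i)) leb => //.
  - by move=> x y; rewrite linearB mulrBr.
  - by move=> x p; rewrite (sigmaM brR) mulrCA mulrA mul_w mulrA.
  - by move=> x y; rewrite (piM brR).
by exists (DiffOp Pf).
Qed.

(** Since [w i] is the generator of the conductor of the branch [i], any operator
  on the branch becomes one on the curve after multiplication by ['X^m]. *)
Definition extend_op i b : diffop K R := projT1 (cid (extend_op_subproof i b)).

Lemma extend_opE i b x : extend_op i b x = w i * sigma (b (pi i x)).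
Proof. exact: (projT2 (cid (extend_op_subproof i b))). Qed.

Lemma pi_extend_op l i b x :
  pi l (extend_op i b x) = if l == i then 'X^m * b (pi i x) else 0.
Proof. by rewrite extend_opE pi_w_sigma. Qed.

Lemma extend_opM_r i b D : extend_op i b * D = extend_op i (b * branch_op i D).
Proof.
apply: diffop_eq => x; rewrite -[LHS]/(extend_op i b (D x)) !extend_opE.
by rewrite branch_opE.
Qed.

Lemma extend_opM_l i b D :
  D * extend_op i b = extend_op i (conductor_op i D * b).
Proof.
apply: diffop_eq => x; rewrite -[LHS]/(D (extend_op i b x)).
apply: pi_eq => l; rewrite branch_opE !pi_extend_op.
by case: eqP => [->|_]; rewrite ?kEnd0 // conductor_opE.
Qed.

Lemma branch_op_extend l i b :
  branch_op l (extend_op i b) = if l == i then mul_diffop 'X^m * b else 0.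
Proof.
apply: diffop_eq => p; rewrite branch_op_sigma pi_extend_op.
by case: eqP => [_|_] //; rewrite (pi_sigma brR).
Qed.

Lemma conductor_op_extend l i b :
  conductor_op l (extend_op i b) = if l == i then b * mul_diffop 'X^m else 0.
Proof.
have Xm0 : 'X^m != 0 :> {poly K} by rewrite expf_eq0 polyX_eq0 andbF.
apply: diffop_eq => p; apply: (mulfI Xm0).
rewrite -conductor_opE branch_op_extend; case: eqP => [_|_] //.
by rewrite mulr0.
Qed.

Lemma branch_opB i D D' : branch_op i (D - D') = branch_op i D - branch_op i D'.
Proof.
apply: diffop_eq => p; rewrite branch_op_sigma.
by rewrite -[RHS]/(branch_op i D p - branch_op i D' p) !branch_op_sigma -linearB.
Qed.

Lemma branch_opM i D D' : branch_op i (D * D') = branch_op i D * branch_op i D'.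
Proof.
apply: diffop_eq => p; rewrite branch_op_sigma.
rewrite -[RHS]/(branch_op i D (branch_op i D' p)).
by rewrite [branch_op i D' p]branch_op_sigma -branch_opE.
Qed.

Lemma conductor_opB i D D' :
  conductor_op i (D - D') = conductor_op i D - conductor_op i D'.
Proof.
have Xm0 : 'X^m != 0 :> {poly K} by rewrite expf_eq0 polyX_eq0 andbF.
apply: diffop_eq => p; apply: (mulfI Xm0); rewrite -conductor_opE branch_opB.
rewrite -[RHS]/('X^m * (conductor_op i D p - conductor_op i D' p)) mulrBr.
by rewrite -!conductor_opE.
Qed.

Lemma conductor_opM i D D' :
  conductor_op i (D * D') = conductor_op i D * conductor_op i D'.
Proof.
have Xm0 : 'X^m != 0 :> {poly K} by rewrite expf_eq0 polyX_eq0 andbF.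
apply: diffop_eq => p; apply: (mulfI Xm0); rewrite -conductor_opE branch_opM.
rewrite -[LHS]/(branch_op i D (branch_op i D' ('X^m * p))).
by rewrite !conductor_opE.
Qed.

Lemma extend_opB i b b' : extend_op i (b - b') = extend_op i b - extend_op i b'.
Proof.
apply: diffop_eq => x.
rewrite -[RHS]/(extend_op i b x - extend_op i b' x) !extend_opE.
by rewrite -mulrBr -linearB.
Qed.

Lemma extend_op_scale_l i k b :
  extend_op i (mul_diffop k%:P * b) = mul_diffop k%:A * extend_op i b.
Proof.
apply: diffop_eq => x.
rewrite -[RHS]/(k%:A * extend_op i b x) !extend_opE mulr_algl.
rewrite -[(mul_diffop _ * b) _]/(k%:P * b (pi i x)) mul_polyC linearZ.
by rewrite -scalerAr.
Qed.

Lemma mul_diffop_scalar k D : mul_diffop k%:A * D = D * mul_diffop k%:A.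
Proof.
apply: diffop_eq => x; rewrite -[LHS]/(k%:A * D x) -[RHS]/(D (k%:A * x)).
by rewrite !mulr_algl kEndZ.
Qed.

Lemma extend_op_scale_r i k b :
  extend_op i (b * mul_diffop k%:P) = extend_op i b * mul_diffop k%:A.
Proof.
rewrite -(weyl_central (weyl_like_diffop K)) extend_op_scale_l.
exact: mul_diffop_scalar.
Qed.

(** The coefficients of the operators that [D] induces on the finite-dimensional
  algebra [K[t] / 'X^m] attached to each branch. *)
Definition branch_coef (s : I * 'I_m * 'I_m) D : K :=
  (branch_op s.1.1 D 'X^(s.1.2))`_s.2.

Lemma branch_coefB s D D' :
  branch_coef s (D - D') = branch_coef s D - branch_coef s D'.
Proof.
rewrite /branch_coef branch_opB.
rewrite -[LHS]/((branch_op s.1.1 D 'X^(s.1.2) -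
                 branch_op s.1.1 D' 'X^(s.1.2))`_s.2).
exact: coefB.
Qed.

Lemma branch_coefZ s k D :
  branch_coef s (mul_diffop k%:A * D) = k * branch_coef s D.
Proof.
rewrite /branch_coef !branch_op_sigma.
rewrite -[LHS]/((pi s.1.1 (k%:A * D (sigma 'X^(s.1.2))))`_s.2).
by rewrite mulr_algl linearZ coefZ.
Qed.

Lemma branch_coefZ_r s k D :
  branch_coef s (D * mul_diffop k%:A) = k * branch_coef s D.
Proof. by rewrite -mul_diffop_scalar branch_coefZ. Qed.

(** If [D] acts by zero on [K[t] / 'X^m] for each branch, then it maps the
  normalization into the conductor, and division by ['X^m] gives the [b i]. *)
Lemma branch_coef0 D : (forall s, branch_coef s D = 0) ->
  exists b : I -> weyl, D = \sum_i extend_op i (b i).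
Proof.
move=> zeroD.
have divD i p : exists q, branch_op i D p = 'X^m * q.
  pose P p := exists q, branch_op i D p = 'X^m * q.
  rewrite -/(P p) -(poly_take_drop m p).
  have PD u v : P u -> P v -> P (u + v).
    by move=> [q qE] [q' q'E]; exists (q + q'); rewrite kEndD qE q'E mulrDr.
  apply: (PD); last by rewrite mulrC; apply: branch_op_conductor.
  rewrite /take_poly poly_def; apply: (big_ind P) => [|u v|a _].
  - by exists 0; rewrite kEnd0 mulr0.
  - exact: PD.
  have [q qE] : P 'X^a.
    exists (drop_poly m (branch_op i D 'X^a)).
    rewrite -[LHS](poly_take_drop m) mulrC [X in X + _](_ : _ = 0) ?add0r //.
    apply/polyP => l; rewrite coef_take_poly coef0; case: ifP => // lt_l.
    exact: (zeroD (i, a, Ordinal lt_l)).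
  by exists (p`_a *: q); rewrite kEndZ qE -scalerAr.
have exb i : exists b : weyl, forall p, branch_op i D p = 'X^m * b p.
  have [f fE] := choice (divD i).
  have Xm0 : 'X^m != 0 :> {poly K} by rewrite expf_eq0 polyX_eq0 andbF.
  have lin_f : linear f.
    move=> k p q; apply: (mulfI Xm0).
    by rewrite -fE kEndD kEndZ !fE mulrDr -scalerAr.
  have [n leD] := diffop_leP (branch_op i D).
  have Pf : lin_kEnd lin_f \in @is_diffop K {poly K}.
    by apply/asboolP; exists n; apply: diffop_le_div Xm0 _ leD => p; rewrite -fE.
  by exists (DiffOp Pf) => p; rewrite fE.
have [b bE] := choice exb; exists b; apply: diffop_eq => x.
apply: pi_eq => l.
have -> : (\sum_i extend_op i (b i) : diffop K R) x =
          \sum_i extend_op i (b i) x.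
  by elim/big_rec2: _ => [//|i y D' _ <-].
rewrite linear_sum (bigD1 l) //= big1 => [|i neq_i].
  by rewrite addr0 pi_extend_op eqxx branch_opE bE.
by rewrite pi_extend_op eq_sym (negPf neq_i).
Qed.

(** The two representations of the operators on the curve, on its normalization
  and on its conductor, are exchanged by passing to the converse rings. *)
Lemma line_branches_noetherian :
  [pchar K] =i pred0 -> noetherian (diffop K R).
Proof.
move=> charK; have weylK := weyl_like_diffop K.
split; last first.
  apply: (@left_coord_noetherian K weyl (diffop K R)
    (fun k => mul_diffop k%:P) (fun k => mul_diffop k%:A) I _
    (mul_diffop 'X^m) branch_op extend_op branch_coef).
  - split.
    + exact: branch_opB.
    + exact: branch_opM.
    + exact: extend_opB.
    + exact: extend_op_scale_l.
    + exact: extend_opM_r.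
    + by move=> i l b; apply: branch_op_extend.
    + exact: branch_coefB.
    + exact: branch_coefZ.
    + exact: branch_coef0.
  - by move=> k; apply: (weyl_central weylK).
  - exact: weyl_left_noetherian charK weylK.
  - by move=> N; apply: (acc_weyl_kernelX charK weylK).
have weylC := weyl_like_converse weylK.
suff noethC : left_noetherian (diffop K R)^c.
  by move=> J idJ; apply: noethC => n; case: (idJ n).
apply: (@left_coord_noetherian K weyl^c (diffop K R)^c
  (fun k => mul_diffop k%:P) (fun k => mul_diffop k%:A) I _
  (mul_diffop 'X^m) conductor_op extend_op branch_coef).
- split.
  + exact: conductor_opB.
  + by move=> i D D'; apply: conductor_opM.
  + exact: extend_opB.
  + exact: extend_op_scale_r.
  + by move=> i b D; apply: extend_opM_l.
  + by move=> i l b; apply: conductor_op_extend.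
  + exact: branch_coefB.
  + exact: branch_coefZ_r.
  + exact: branch_coef0.
- by move=> k; apply: (weyl_central weylC).
- exact: weyl_left_noetherian charK weylC.
- by move=> N; apply: (acc_weyl_kernelX charK weylC).
Qed.

End LineBranches.

(** * Lines in the plane *)

Section PlaneLine.
Variable K : fieldType.
Implicit Types (v : 'rV[K]_2) (f p : {mpoly K[2]}).

(** The restriction of a polynomial to the line spanned by [v], as a polynomial
  in the parameter [t] of the point [t v]. *)
Definition restr v : {mpoly K[2]} -> {poly K} :=
  mmap (@polyC K) (fun j => v 0 j *: 'X).

HB.instance Definition _ v := GRing.RMorphism.on (restr v).

Lemma restrZ v k f : restr v (k *: f) = k *: restr v f.
Proof. by rewrite /restr mmapZ mul_polyC. Qed.

Lemma restrX v j : restr v 'X_j = v 0 j *: 'X.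
Proof. by rewrite /restr mmapX mmap1U. Qed.

Lemma restr_homog v p : p \is 1.-homog -> restr v p = p.@[v 0] *: 'X.
Proof.
move=> homp; rewrite /restr /meval /mmap scaler_suml; apply: eq_big_seq => m mp.
have /eqP/mdeg1P[j /eqP ->] := dhomog_mf homp mp.
by rewrite !mmap1U mul_polyC scalerA.
Qed.

Lemma ord2P (j : 'I_2) : j = 0 \/ j = 1.
Proof. by case: j => [[|[|]]] // lt_j; [left|right]; apply: val_inj. Qed.

Lemma linear_form p :
  p \is 1.-homog -> p = p@_U_(0) *: 'X_0 + p@_U_(1) *: 'X_1.
Proof.
move=> homp; apply/mpolyP => m; rewrite mcoeffD !mcoeffZ !mcoeffX.
have [/mdeg1P[j /eqP->]|m1] := boolP (mdeg m == 1%N).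
  have neq01 : (U_(0%R) == U_(1%R) :> 'X_{1..2})%MM = false.
    by apply/eqP => /mnmP/(_ 0%R); rewrite !mnm1E.
  case: (ord2P j) => ->; rewrite !eqxx ?neq01 1?eq_sym ?neq01.
    by rewrite mulr0 mulr1 addr0.
  by rewrite mulr0 mulr1 add0r.
rewrite (dhomog_nemf_coeff homp m1).
have U0 j : (U_(j) == m)%MM = false.
  by apply: contraNF m1 => /eqP <-; rewrite mdeg1.
by rewrite !U0 !mulr0 addr0.
Qed.

Variable s : K.

(** A linear form whose zero line is transversal to the lines under study; it
  serves as a common parameter for them. *)
Definition transversal : {mpoly K[2]} := 'X_0 + s *: 'X_1.

Definition param_lift : {poly K} -> {mpoly K[2]} := horner_alg transversal.

HB.instance Definition _ := GRing.RMorphism.on param_lift.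

Lemma param_liftZ k q : param_lift (k *: q) = k *: param_lift q.
Proof. by rewrite -mul_polyC rmorphM /= /param_lift horner_algC mulr_algl. Qed.

Lemma restr_param_lift v q : v 0 0 + s * v 0 1 = 1 -> restr v (param_lift q) = q.
Proof.
move=> v1; elim/poly_ind: q => [|q c IHq]; first by rewrite !rmorph0.
rewrite !rmorphD !rmorphM /= IHq /param_lift horner_algX horner_algC.
rewrite restrZ rmorph1 alg_polyC; congr (_ * _ + _).
by rewrite /transversal rmorphD /= restrZ !restrX scalerA -scalerDl v1 scale1r.
Qed.

(** Modulo the equation of the line spanned by [v], the coordinate functions,
  hence all polynomials, are polynomials in the transversal parameter. *)
Lemma restr_mod v f : v 0 0 + s * v 0 1 = 1 ->
  exists g, f - param_lift (restr v f) = (v 0 1 *: 'X_0 - v 0 0 *: 'X_1) * g.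
Proof.
move=> v1; set q := v 0 1 *: 'X_0 - _.
pose P f := exists g, f - param_lift (restr v f) = q * g.
have PD f1 f2 : P f1 -> P f2 -> P (f1 + f2).
  move=> [g1 E1] [g2 E2]; exists (g1 + g2).
  by rewrite !rmorphD opprD addrACA E1 E2 mulrDr.
have PM f1 f2 : P f1 -> P f2 -> P (f1 * f2).
  move=> [g1 E1] [g2 E2]; exists (g1 * f2 + param_lift (restr v f1) * g2).
  rewrite mulrDr mulrA -E1 mulrCA -E2 !rmorphM /=; ring.
have PC c : P c%:MP.
  exists 0; rewrite mulr0 /restr mmapC /param_lift horner_algC.
  by rewrite -mul_mpolyC mulr1 subrr.
have PX j : P 'X_j.
  have v00 : v 0 0 = 1 - s * v 0 1 by rewrite -v1 addrK.
  have liftX : param_lift (restr v 'X_j) = v 0 j *: transversal.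
    by rewrite restrX param_liftZ /param_lift horner_algX.
  (* ['X_0 - v 0 0 *: transversal] is [s *: q], and
     ['X_1 - v 0 1 *: transversal] is [- q]. *)
  case: (ord2P j) liftX => -> liftX; [exists s%:MP | exists (- 1)].
    rewrite liftX /q /transversal v00 -!mul_mpolyC !(mpolyCB, mpolyCM, mpolyC1).
    ring.
  rewrite liftX /q /transversal v00 -!mul_mpolyC !(mpolyCB, mpolyCM, mpolyC1).
  ring.
change (P f); elim/mpolyind: f => [|c m p _ _ Pp].
  by rewrite -(mpolyC0 2 K); apply: PC.
apply: (PD) => //; rewrite -mul_mpolyC; apply: (PM) => //.
rewrite mpolyXE_id; apply: (big_ind P) => // [|j _].
  by rewrite -mpolyC1; apply: PC.
elim: (m j) => [|k IHk]; first by rewrite expr0 -mpolyC1; apply: PC.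
by rewrite exprS; apply: (PM).
Qed.

End PlaneLine.

(** * The coordinate ring of a central arrangement *)

Lemma natr_inj (K : fieldType) : [pchar K] =i pred0 ->
  injective (fun n => n%:R : K).
Proof.
move=> charK m n; wlog le_mn : m n / (m <= n)%N.
  by move=> le_inj; case/orP: (leq_total m n) => le E; [|apply/esym]; apply: le_inj.
move=> E; apply/eqP; rewrite eqn_leq le_mn -subn_eq0.
by rewrite -((pcharf0P K).1 charK) natrB // E subrr eqxx.
Qed.

Lemma exists_transversal (K : fieldType) (I : finType) (u : I -> 'rV[K]_2) :
  [pchar K] =i pred0 -> (forall i, u i != 0) ->
  exists s, forall i, u i 0 0 + s * u i 0 1 != 0.
Proof.
move=> charK u0; pose P : {poly K} := \prod_i ((u i 0 0)%:P + u i 0 1 *: 'X).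
have P0 : P != 0.
  apply/prodf_neq0 => i _; apply: contraNneq (u0 i) => /polyP uE.
  have := uE 0%N; have := uE 1%N.
  rewrite !coefD !coefC !coefZ !coefX /= mulr0 mulr1 add0r addr0 => u1 u00.
  by apply/eqP/rowP => j; rewrite mxE; case: (ord2P j) => ->.
pose rs : seq K := [seq n%:R | n <- iota 0 (size P)].
have : ~~ all (root P) rs.
  apply/negP => rootP; have := max_poly_roots P0 rootP.
  rewrite map_inj_uniq ?iota_uniq; last exact: natr_inj.
  by rewrite size_map size_iota ltnn => /(_ isT).
case/allPn => s _ Ps; exists s => i; apply: contraNneq Ps => us.
rewrite rootE horner_prod (bigD1 i) //= hornerD hornerC hornerZ hornerX.
by rewrite mulrC in us; rewrite us mul0r.
Qed.

Lemma exists_directions (K : fieldType) (A : central_arrangement K) :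
  [pchar K] =i pred0 ->
  exists s (v : 'I_(nlines A) -> 'rV[K]_2),
    forall i, v i \in line i /\ v i 0 0 + s * v i 0 1 = 1.
Proof.
move=> charK.
have [i|s sP] := exists_transversal (u := fun i => vpick (line (c := A) i)) charK.
  by rewrite vpick0 -dimv_eq0 dim_line.
exists s, (fun i => (vpick (line i) 0 0 + s * vpick (line i) 0 1)^-1 *:
                    vpick (line i)) => i.
split; first by rewrite memvZ // memv_pick.
by rewrite !mxE mulrCA -mulrDr mulVf.
Qed.

Section Arrangement.
Variables (K : fieldType) (A : central_arrangement K).
Variables (s : K) (v : 'I_(nlines A) -> 'rV[K]_2).
Hypothesis v_line : forall i, v i \in line i.
Hypothesis v_s : forall i, v i 0 0 + s * v i 0 1 = 1.
Local Notation I := 'I_(nlines A).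
Local Notation S := {mpoly K[2]}.
Implicit Types (i l : I) (f g : S).

Lemma line_span i : line i = <[v i]>%VS.
Proof.
have v0 : v i != 0.
  apply: contra_eq_neq (v_s i) => ->.
  by rewrite !mxE mulr0 addr0 eq_sym oner_eq0.
by apply/esym/eqP; rewrite eqEdim dim_vline v0 dim_line -memvE v_line.
Qed.

Lemma form_off_line i l : i != l -> (line_form i).@[v l 0] != 0.
Proof.
apply: contra_neqN; rewrite -line_formP => vl; apply: (@line_inj _ A).
by apply/esym/eqP; rewrite eqEdim !dim_line leqnn andbT line_span -memvE.
Qed.

Lemma restr_form i l : restr (v l) (line_form i) = (line_form i).@[v l 0] *: 'X.
Proof. exact/restr_homog/line_form_homog. Qed.

Lemma restr_form_diag i : restr (v i) (line_form i) = 0.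
Proof.
by rewrite restr_form; have := v_line i; rewrite line_formP => /eqP->; rewrite scale0r.
Qed.

Lemma line_form_eq i : exists2 mu, mu != 0 &
  line_form i = mu *: (v i 0 1 *: 'X_0 - v i 0 0 *: 'X_1).
Proof.
have lin := linear_form (line_form_homog i).
set a := _@__ in lin; set b := (line_form i)@__ in lin.
(* The factor [mu] comes from solving this equation together with [v_s]. *)
have ab : a * v i 0 0 + b * v i 0 1 = 0.
  have := v_line i; rewrite line_formP lin mevalD !mevalZ !mevalXU.
  by move/eqP.
have aE : a = (a * s - b) * v i 0 1.
  rewrite -[LHS]mulr1 -(v_s i); apply/subr0_eq; rewrite -ab; ring.
have bE : b = - ((a * s - b) * v i 0 0).
  rewrite -[LHS]mulr1 -(v_s i); apply/subr0_eq.
  transitivity (s * (a * v i 0 0 + b * v i 0 1)); last by rewrite ab mulr0.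
  ring.
exists (a * s - b).
  apply/negP => /eqP mu0.
  have form0 : line_form i = 0.
    have a0 : a = 0 by rewrite aE mu0 mul0r.
    have b0 : b = 0 by rewrite bE mu0 mul0r oppr0.
    by rewrite lin a0 b0 !scale0r addr0.
  have : (fullv <= line i)%VS.
    by apply/subvP => x _; rewrite line_formP form0 meval0 eqxx.
  by move/dimvS; rewrite dimvf dim_line dim_matrix.
by rewrite scalerBr !scalerA -aE -scaleNr -bE.
Qed.

Lemma line_form_dvd i f : restr (v i) f = 0 -> exists g, f = line_form i * g.
Proof.
move=> f0; have [mu mu0 ->] := line_form_eq i.
have [g] := restr_mod f (v_s i).
rewrite f0 rmorph0 subr0 => fE; exists (mu^-1 *: g).
by rewrite -scalerAl -scalerAr scalerA mulfV // scale1r.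
Qed.

(** The forms of distinct lines are pairwise coprime, because each of them
  restricts to a nonzero multiple of the parameter on the other lines. *)
Lemma prod_form_dvd (r : seq I) f : uniq r ->
  (forall i, i \in r -> restr (v i) f = 0) ->
  exists g, f = \prod_(i <- r) line_form i * g.
Proof.
elim: r f => [|i r IHr] f /=; first by exists f; rewrite big_nil mul1r.
case/andP=> ir ur f0; have [|g fE] := @line_form_dvd i f.
  by apply: f0; rewrite mem_head.
have [|l rl|h gE] := IHr g; first exact: ur.
  have : restr (v l) f = 0 by apply: f0; rewrite inE rl orbT.
  rewrite fE rmorphM /= restr_form => /eqP.
  rewrite mulf_eq0 scaler_eq0 polyX_eq0 orbF (negPf (form_off_line _)) /=.
    by move/eqP.
  by apply: contraNneq ir => ->.
by exists h; rewrite big_cons fE gE mulrA.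
Qed.

Local Notation Q := {ideal_quot (defining_ideal A : idealr {mpoly K[2]})}.
Local Open Scope quotient_scope.

Lemma defining_ideal_restr i f : f \in defining_ideal A -> restr (v i) f = 0.
Proof.
move=> /asboolP[g ->]; rewrite rmorphM /= /defining_poly rmorph_prod.
by rewrite (bigD1 i) //= restr_form_diag !mul0r.
Qed.

Lemma restr_quot_subproof i :
  exists h : {linear Q -> {poly K}}, forall f, h (\pi_Q f) = restr (v i) f.
Proof.
pose h (x : Q) := restr (v i) (repr x).
have hE f : h (\pi_Q f) = restr (v i) f.
  apply/subr0_eq; rewrite -rmorphB; apply: defining_ideal_restr.
  by rewrite Quotient.idealrBE reprK.
have lin_h : linear h.
  move=> k x y; rewrite -[x]reprK -[y]reprK pi_scale -rmorphD !hE.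
  by rewrite rmorphD /= restrZ.
by exists (lin_map lin_h).
Qed.

Definition restr_quot i : {linear Q -> {poly K}} :=
  projT1 (cid (restr_quot_subproof i)).

Lemma restr_quotE i f : restr_quot i (\pi_Q f) = restr (v i) f.
Proof. exact: (projT2 (cid (restr_quot_subproof i))). Qed.

Lemma param_quot_linear : linear (fun q => \pi_Q (param_lift s q)).
Proof. by move=> k p q; rewrite rmorphD /= param_liftZ rmorphD /= -pi_scale. Qed.

Definition param_quot : {linear {poly K} -> Q} := lin_map param_quot_linear.

(** The scalar makes the product of the equations of the other lines restrict
  to a power of the parameter on the line [i]; see [restr_other_lines]. *)
Definition branch_generator i : Q :=
  \pi_Q ((\prod_(l | l != i) (line_form l).@[v i 0])^-1 *:
         \prod_(l | l != i) line_form l).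

Lemma restr_other_lines i : restr (v i) (\prod_(l | l != i) line_form l) =
  (\prod_(l | l != i) (line_form l).@[v i 0]) *: 'X^((nlines A).-1).
Proof.
rewrite rmorph_prod /= (eq_bigr (fun l => ((line_form l).@[v i 0])%:P * 'X)).
  rewrite big_split /= -rmorph_prod /= mul_polyC prodr_const; congr (_ *: _ ^+ _).
  by rewrite cardC1 card_ord.
by move=> l _; rewrite restr_form mul_polyC.
Qed.

Lemma arrangement_branches :
  line_branches restr_quot param_quot branch_generator (nlines A).-1.
Proof.
split.
- move=> i x y; rewrite -[x]reprK -[y]reprK -rmorphM !restr_quotE.
  by rewrite rmorphM.
- by move=> p q; rewrite -[LHS]/(\pi_Q _) !rmorphM.
- move=> i p; rewrite -[param_quot p]/(\pi_Q _) restr_quotE.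
  exact: restr_param_lift.
- move=> x; rewrite -[x]reprK => x0.
  have [||g gE] := @prod_form_dvd (index_enum I) (repr x).
  + exact: index_enum_uniq.
  + by move=> i _; rewrite -restr_quotE.
  apply/eqP; rewrite -(rmorph0 \pi_Q) -Quotient.idealrBE subr0.
  by apply/asboolP; exists g.
- move=> l i; rewrite restr_quotE restrZ.
  case: eqP => [->|/eqP neq_li].
    rewrite restr_other_lines scalerA mulVf ?scale1r //.
    by apply/prodf_neq0 => k; apply: form_off_line.
  rewrite [X in _ *: X](_ : _ = 0) ?scaler0 // rmorph_prod (bigD1 l) //=.
  by rewrite restr_form_diag mul0r.
- move=> i x; rewrite -[x]reprK => x0.
  have [||g gE] := @prod_form_dvd [seq l <- index_enum I | l != i] (repr x).
  + exact/filter_uniq/index_enum_uniq.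
  + move=> l; rewrite mem_filter => /andP[neq_li _].
    by rewrite -restr_quotE x0.
  exists (\prod_(l | l != i) (line_form l).@[v i 0] *: restr (v i) g).
  rewrite restr_quotE {1}gE rmorphM /= big_filter restr_other_lines.
  by rewrite -scalerAl -scalerAr.
Qed.

End Arrangement.

Theorem theorem4p16 (K : fieldType) (charK : [pchar K] =i pred0)
    (A : central_arrangement K) :
  noetherian (diffop K {ideal_quot (defining_ideal A : idealr {mpoly K[2]})}).
Proof.
have [s [v vP]] := exists_directions A charK.
apply: line_branches_noetherian charK.
exact: arrangement_branches (fun i => (vP i).1) (fun i => (vP i).2).
Qed.
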